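(* Let $1\le q<\infty$. There exists a constant $C$ depending only on $q$ such that the following holds. Let $(\Omega,\mathcal A,\mu)$ be a probability space, let $X$ be distributed as $\mu$, let $\mathcal F\subset L^q(\mu)$ be a class of real-valued functions on $\Omega$ containing the zero function, and suppose that $\mathcal F$ has sub-Gaussian increments with respect to a distance $d_{\psi_2}$ on $\mathcal F$. Let $N\ge 1$ be an integer and let $X_1,\dots,X_N$ be independent copies of $X$. Then for every $u\ge 1$, with probability at least $1-\exp(-u)$, $$\sup_{f\in\mathcal F}\left|\frac1N\sum_{i=1}^N|f(X_i)|^q-\mathbb E|f(X)|^q\right|\le C\left(\frac{\gamma_2(\mathcal F)^q}{N^{\min\{1,q/2\}}}+\operatorname{diam}(\mathcal F)^{q-1}\frac{\gamma_2(\mathcal F)}{\sqrt N}+\operatorname{diam}(\mathcal F)^q\left(\sqrt{\frac uN}+\frac{u^{q/2}}{N^{\min\{1,q/2\}}}\right)\right).$$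
   Context: Sub-Gaussian increments: $\mathcal F$ has sub-Gaussian increments with respect to the distance $d_{\psi_2}$ if, for some absolute constant $C_1>1$ (fixed once and for all), for all $f,g\in\mathcal F$ and all $u>0$, $\mathbb P(|f(X)-g(X)|\ge u)\le C_1\exp\left(-u^2/d_{\psi_2}(f,g)^2\right)$. Talagrand's functional: for a metric space $(T,d)$, a sequence $(T_n)_{n\ge 0}$ of finite subsets of $T$ is admissible if $|T_0|=1$, $|T_n|\le 2^{2^n}$, $T_n\subset T_{n+1}$, and $\bigcup_{n\ge0}T_n$ is dense in $T$. Then $\gamma_2(T,d)=\inf\sup_{v\in T}\sum_{n=0}^\infty 2^{n/2}d(v,T_n)$, where the infimum is over all admissible sequences. Notation: $\gamma_2(\mathcal F)=\gamma_2(\mathcal F,d_{\psi_2})$, and $\operatorname{diam}(\mathcal F)$ is the diameter of $\mathcal F$ with respect to $d_{\psi_2}$.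
   Formalization: The supremum is taken over separable subclasses of F (F itself if separable, e.g. countable), with γ₂ and diam of all of F; over arbitrary uncountable F the claim fails, e.g. for singleton indicators under Lebesgue measure with a tiny distance. *)

(* Defs.v *)
From HB Require Import structures.
From mathcomp Require Import all_boot all_order all_algebra.
From mathcomp Require Import all_classical all_reals all_analysis.

Set Implicit Arguments.
Unset Strict Implicit.
Unset Printing Implicit Defensive.

Import Order.TTheory GRing.Theory Num.Theory.
Import numFieldNormedType.Exports.

Local Open Scope classical_set_scope.
Local Open Scope card_scope.
Local Open Scope ring_scope.

(* In the chaining notions below, the metric space (T, d) is a subset [A] of an
   ambient type on which [d] is a total function; only the values of [d] on [A]
   matter. *)
Section chaining.
Context {R : realType} {T : Type}.
Implicit Types (d : T -> T -> R) (A : set T).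

(* [#<= `I_k] entails finiteness. *)
Definition admissible d A (A_ : nat -> set T) : Prop :=
  [/\ forall n, A_ n `<=` A,
      A_ 0%N #= `I_1,
      forall n, A_ n #<= `I_(2 ^ (2 ^ n))%N,
      forall n, A_ n `<=` A_ n.+1 &
      forall v, A v -> forall e : R, 0 < e ->
        exists n t, A_ n t /\ d v t < e].

Definition dist_set d (v : T) (B : set T) : \bar R :=
  ereal_inf [set (d v t)%:E | t in B].

(* Values in [\bar R]: [+oo] when no admissible sequence gives a finite
   supremum (in particular when there is none). *)
Definition gamma2 d A : \bar R :=
  ereal_inf [set ereal_sup
      [set (\sum_(0 <= n <oo) ((2 `^ (n%:R / 2))%:E * dist_set d v (A_ n)))%E
      | v in A]
    | A_ in admissible d A].

Definition diameter d A : \bar R :=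
  ereal_sup [set (d f g)%:E | f in A & g in A].

End chaining.

Definition independent_RVs {R : realType} {dW dT : measure_display}
    {W : measurableType dW} {T : measurableType dT} (P : probability W R)
    (N : nat) (X_ : 'I_N -> W -> T) : Prop :=
  forall B : 'I_N -> set T, (forall i, measurable (B i)) ->
    (P (\bigcap_(i in [set: 'I_N]) (X_ i @^-1` B i))
     = \prod_(i < N) P (X_ i @^-1` B i))%E.

Section function_classes.
Context {R : realType} {dT : measure_display} {T : measurableType dT}.
Variable mu : probability T R.
Implicit Types (F : set (T -> R)) (d : (T -> R) -> (T -> R) -> R).

(* Elements of L^q(mu) are functions up to mu-a.e. equality, so [d f g = 0] is
   only required to give [f = g] mu-a.e.; every metric on a set of functions is
   a distance in this sense. *)
Definition is_distance d F : Prop :=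
  [/\ forall f g, F f -> F g -> 0 <= d f g,
      forall f, F f -> d f f = 0,
      forall f g, F f -> F g -> d f g = 0 -> {ae mu, forall x, f x = g x},
      forall f g, F f -> F g -> d f g = d g f &
      forall f g h, F f -> F g -> F h -> d f h <= d f g + d g h].

(* Separability in Doob's sense, uniformly in the sample point: up to one
   mu-null set, every element of [G] is a pointwise limit of elements of a fixed
   countable subclass that also converge to it for [d].  Every countable class is
   separable. *)
Definition separable_class d (G : set (T -> R)) : Prop :=
  exists2 G0 : set (T -> R), countable G0 /\ G0 `<=` G &
  exists2 M : set T, mu.-negligible M &
  forall f, G f -> exists f_ : nat -> T -> R,
    [/\ forall n, G0 (f_ n),
        d (f_ n) f @[n --> \oo] --> (0 : R) &
        forall x, ~ M x -> f_ n x @[n --> \oo] --> f x].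

End function_classes.

(* If [d f g = 0], the right-hand side of the bound is [C1 > 1] by the convention
   [0^-1 = 0], and the intended bound [0] holds by [is_distance]. *)
Definition subgaussian_increments {R : realType} {dW dT : measure_display}
    {W : measurableType dW} {T : measurableType dT} (C1 : R)
    (P : probability W R) (X : W -> T) (d : (T -> R) -> (T -> R) -> R)
    (F : set (T -> R)) : Prop :=
  forall f g, F f -> F g -> forall u : R, 0 < u ->
    (P [set w | (u <= `|f (X w) - g (X w)|)%R]
     <= (C1 * expR (- (u ^+ 2 / d f g ^+ 2)))%:E)%E.

Definition empirical_deviation {R : realType} {dW dT : measure_display}
    {W : measurableType dW} {T : measurableType dT} (P : probability W R)
    (q : R) (N : nat) (X : W -> T) (X_ : 'I_N -> W -> T) (f : T -> R) (w : W)
    : \bar R :=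
  `| (N%:R^-1 * \sum_(i < N) `|f (X_ i w)| `^ q)%R%:E
     - 'E_P[(fun w' => `|f (X w')| `^ q)%R] |%E.

(* Main.v *)
Require Import Defs.
From HB Require Import structures.
From mathcomp Require Import all_boot all_order all_algebra.
From mathcomp Require Import finmap.
From mathcomp Require Import all_classical all_reals all_analysis.
From mathcomp Require Import measurable_realfun ring lra.

Set Implicit Arguments.
Unset Strict Implicit.
Unset Printing Implicit Defensive.

Import Order.TTheory GRing.Theory Num.Theory.
Import numFieldNormedType.Exports.

Local Open Scope classical_set_scope.
Local Open Scope ring_scope.

(** Write S(phi) for the sum of phi over the sample, A_n for the n-th set of an
    admissible sequence, pi_n f for a nearly closest point of f in A_n, and D for
    the diameter.  The theorem is proved by generic chaining, where the difficulty
    is that |f|^q has tails heavier than exponential as soon as q > 2, so that a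
    plain Bernstein chaining would produce a functional larger than gamma2.

    The remedy is to treat each link (a, b) of a chain by truncation.  Let
    h = |a|^q - |b|^q, let delta bound the distance of a and b, and let t be the
    number of bits available at this level, so that an event of probability
    exp(-6t) can be discarded.  The values of h below
    delta D^(q-1) sqrt(N/t) satisfy Bernstein's inequality in its Gaussian regime
    and contribute delta D^(q-1) sqrt(Nt).  The values above this threshold are so
    rare that the sum of (a-b)^2 over the corresponding sample points is at most of
    order delta^2 t; since |h| <= q|a-b|(|a|^(q-1) + |b|^(q-1)), they contribute
    at most delta sqrt(t) times the Euclidean norm of |f|^(q-1) on the sample, for
    f = a, b.  Nothing is lost when t > N, hence the same estimate
    (power_increment_tail) serves all levels of the chain, with no special
    treatment of the levels beyond log N.

    Both parts rest on elementary exponential moments: expR_truncated and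
    expR_min bound the exponential of a truncated variable pointwise by an
    integrable function, and Chernoff's inequality for independent variables
    (chernoff_iid) does the rest.

    Summing the links gives
      |S(|f|^q) - N E|f|^q| <= C (gamma2 + D sqrt u) (sqrt N D^(q-1) + V),
    where V bounds the Euclidean norms above uniformly over all links.  The bound on V
    is obtained by a second chaining (uniform_power_sum), now for the l_p norm of
    f on the sample with p = max(2, 2q-2): it starts at the level where 2^n
    exceeds N^(2/p) and u, and there every link has l_p norm at most a constant
    times delta 2^(n/2).  Hence this norm is at most a constant times
    D N^(1/p) + D sqrt u + gamma2 (sum_sqr_powR_le turns this into a bound on V), and
    Young's inequality yields the stated rate (deviation_le_rate).

    The chainings are carried out on finite classes H, where the chain of f stops
    at f itself (generic_chaining), so that no infinite chain has to converge.
    Monotone continuity of the measure passes to countable classes, and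
    separability to G. *)

(** * Power and exponential inequalities *)

Section real_inequalities.
Context {R : realType}.
Implicit Types (x y z p q r : R).

(** With y = (r / e) z this is the inequality ln z <= z. *)
Lemma powR_le_expR r e : 0 <= r -> 0 < e ->
  exists2 c : R, 1 <= c & forall y, 0 <= y -> y `^ r <= c * expR (e * y).
Proof.
rewrite le_eqVlt => /predU1P[<- e0|r0 e0].
  exists 1 => // y y0; rewrite powRr0 mul1r -expR0 ler_expR.
  by rewrite mulr_ge0// ltW.
have re0 : 0 < r / e by rewrite divr_gt0.
exists (Num.max 1 ((r / e) `^ r)) => [|y]; first by rewrite le_max lexx.
rewrite le_eqVlt => /predU1P[<-|y0].
  by rewrite powR0 ?gt_eqF// mulr_ge0// ?expR_ge0// le_max ler01.
apply: (@le_trans _ _ ((r / e) `^ r * expR (e * y))); last first.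
  by rewrite ler_wpM2r ?expR_ge0// le_max lexx orbT.
rewrite /powR !gt_eqF// -expRD ler_expR.
have /ltW : ln (e * y / r) < e * y / r by apply: ln_sublinear; rewrite !(mulr_gt0, invr_gt0).
rewrite !(lnM, lnV) ?posrE ?(mulr_gt0, invr_gt0)// => h.
have : r * (ln e + ln y - ln r) <= r * (e * y / r) by rewrite ler_pM2l.
by rewrite [X in _ <= X]mulrC divfK ?gt_eqF//; lra.
Qed.

(** For b <= a, Young's inequality for the conjugate exponents q and q / (q - 1)
    bounds b a^(q-1), which gives the tangent line inequality
    a^q - b^q <= q a^(q-1) (a - b). *)
Lemma powR_diff q x y : 1 <= q -> 0 <= x -> 0 <= y ->
  `|x `^ q - y `^ q| <= q * (`|x - y| * (x `^ (q - 1) + y `^ (q - 1))).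
Proof.
move=> q1; have q0 : 0 < q by lra.
suff H a b : 0 <= b -> b <= a -> a `^ q - b `^ q <= q * ((a - b) * a `^ (q - 1)).
  move=> x0 y0; wlog yx : x y x0 y0 / y <= x => [hw|].
    have [/hw|/ltW/hw] := leP y x; first exact.
    by rewrite distrC (distrC y x) (addrC (y `^ _)); apply.
  rewrite ger0_norm; last by rewrite subr_ge0 ge0_ler_powR ?nnegrE// ltW.
  rewrite ger0_norm ?subr_ge0//; apply: (le_trans (H _ _ y0 yx)).
  rewrite ler_wpM2l ?(ltW q0)// ler_wpM2l ?subr_ge0// lerDl; exact: powR_ge0.
move=> b0 ba; have a0 : 0 <= a by exact: le_trans ba.
move: q1; rewrite le_eqVlt => /predU1P[<-|q1].
  by rewrite subrr powRr0 !powRr1//; lra.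
have := @conjugate_powR R b (a `^ (q - 1)) q (q / (q - 1)) b0 (powR_ge0 _ _) q0.
have -> : q^-1 + (q / (q - 1))^-1 = 1 by field; rewrite !gt_eqF// subr_gt0.
rewrite divr_gt0 ?subr_gt0// => /(_ isT erefl).
rewrite -powRrM mulrC mulrCA divff ?mulr1; last by rewrite gt_eqF// subr_gt0.
rewrite -(ler_pM2l q0) => h.
have -> : q * ((a - b) * a `^ (q - 1)) = q * a `^ q - q * (a `^ (q - 1) * b).
  by rewrite -(mulr_powRB1 a0 q0); ring.
move: h; rewrite mulrDr (mulrC q (b `^ q / q)) divfK ?gt_eqF// invf_div.
have -> : q * (a `^ q * ((q - 1) / q)) = (q - 1) * a `^ q.
  by field; rewrite gt_eqF.
lra.
Qed.

Lemma powRD_le p x y : 0 <= p -> 0 <= x -> 0 <= y ->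
  (x + y) `^ p <= 2 `^ p * (x `^ p + y `^ p).
Proof.
move=> p0 x0 y0; wlog yx : x y x0 y0 / y <= x => [hw|].
  have [/hw|/ltW/hw] := leP y x; first exact.
  by rewrite addrC (addrC (y `^ _)); apply.
apply: (@le_trans _ _ ((2 * x) `^ p)).
  by rewrite ge0_ler_powR// ?nnegrE; lra.
by rewrite powRM// ler_wpM2l ?powR_ge0// lerDl powR_ge0.
Qed.

(** From 1 - x/2 <= exp(-x/2), squared; the constant 2 makes the remaining
    polynomial inequality hold up to x = 1. *)
Lemma expR_le_quadratic x : x <= 1 -> expR x <= 1 + x + 2 * x ^+ 2.
Proof.
move=> x1.
have h : 1 - x / 2 <= expR (- (x / 2)) by exact: expR_ge1Dx.
have h0 : 0 < 1 - x / 2 by lra.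
have h2 : (1 - x / 2) ^+ 2 <= expR (- x).
  have -> : expR (- x) = expR (- (x / 2)) ^+ 2.
    by rewrite expr2 -expRD; congr expR; lra.
  by rewrite ler_sqr ?nnegrE ?expR_ge0// ltW.
rewrite -[expR x]invrK -expRN invf_ple ?posrE ?expR_gt0//; last by nra.
apply: le_trans h2; rewrite -[leLHS]mul1r ler_pdivrMr; last by nra.
have h3 : 0 <= x ^+ 2 * ((1 - x) * (5 / 4 - x / 2)).
  by rewrite mulr_ge0 ?sqr_ge0// mulr_ge0//; lra.
lra.
Qed.

(** The right-hand side is at least 1 outside [-1, 1], so that the exponential of a
    truncated variable is bounded by a polynomial in the variable itself: its
    expectation involves the full mean, and truncation causes no bias. *)
Lemma expR_truncated x :
  expR (if `|x| <= 1 then x else 0) <= 1 + x + 2 * x ^+ 2.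
Proof.
case: ifPn => [|]; first by rewrite ler_norml => /andP[_ /expR_le_quadratic].
rewrite -ltNge => x1; rewrite expR0 -addrA lerDl.
case: (ltrgt0P x) x1 => x0; nra.
Qed.

(** Where a <= 1 the exponential of a is at most linear, and where a > 1 the factor a
    pays for the exponential of b, which may be large. *)
Lemma expR_min (a b : R) : 0 <= a ->
  expR (Num.min a b) <= 1 + 3 * a + a * expR b.
Proof.
move=> a0; have ae : 0 <= a * expR b by rewrite mulr_ge0 ?expR_ge0.
have [a1|a1] := leP a 1.
  apply: (@le_trans _ _ (expR a)); first by rewrite ler_expR ge_min lexx.
  by apply: (le_trans (expR_le_quadratic a1)); nra.
apply: (@le_trans _ _ (a * expR b)); last lra.
apply: (@le_trans _ _ (expR b)); first by rewrite ler_expR ge_min lexx orbT.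
by rewrite -[leLHS]mul1r ler_wpM2r ?expR_ge0// ltW.
Qed.

(** Polynomial factors are absorbed by halving the gain in the exponent. *)
Lemma powR_expR_sqr p : 0 <= p -> exists2 c : R, 1 <= c &
  forall x, `|x| `^ p * expR (x ^+ 2 / 4) <= c * expR (x ^+ 2 / 2).
Proof.
move=> p0; have [||c c1 H] := @powR_le_expR (p / 2) 4^-1; [by lra|by []|].
exists c => // x.
have -> : `|x| `^ p = (x ^+ 2) `^ (p / 2).
  rewrite -real_normK ?num_real// -powR_mulrn// -powRrM; congr (_ `^ _); lra.
have -> : x ^+ 2 / 2 = 4^-1 * x ^+ 2 + x ^+ 2 / 4 by lra.
by rewrite expRD mulrA ler_wpM2r ?expR_ge0// H// sqr_ge0.
Qed.

(** Here x, y, z stand for (a - b) / delta, a / D, b / D and h for the normalized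
    increment of the q-th powers.  Products of exponentials of squares are dominated
    by sums, since 3/8 x^2 + 1/8 y^2 is at most half the larger of x^2 and y^2. *)
Lemma increment_expR_sqr q : 1 <= q -> exists2 c : R, 1 <= c &
  forall x y z h,
    `|h| <= q * (`|x| * (`|y| `^ (q - 1) + `|z| `^ (q - 1))) ->
    h ^+ 2 * expR (x ^+ 2 / 4) <=
      c * (expR (x ^+ 2 / 2) + expR (y ^+ 2 / 2) + expR (z ^+ 2 / 2)).
Proof.
move=> q1; have [||c c1 H] := @powR_le_expR (q - 1) 8^-1; [by lra|by []|].
have powE y : (`|y| `^ (q - 1)) ^+ 2 = (y ^+ 2) `^ (q - 1).
  by rewrite -powR_mulrn ?powR_ge0// powRAC powR_mulrn// real_normK ?num_real.
exists (32 * q ^+ 2 * c).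
  rewrite -[leLHS]mulr1 ler_pM//; nra.
move=> x y z h hle.
have hx : x ^+ 2 <= 8 * expR (x ^+ 2 / 8).
  by have := expR_ge1Dx (x ^+ 2 / 8); lra.
have key v : x ^+ 2 * (`|v| `^ (q - 1)) ^+ 2 * expR (x ^+ 2 / 4) <=
    8 * c * (expR (x ^+ 2 / 2) + expR (v ^+ 2 / 2)).
  rewrite powE.
  apply: (@le_trans _ _ ((8 * expR (x ^+ 2 / 8)) * (c * expR (8^-1 * v ^+ 2))
      * expR (x ^+ 2 / 4))).
    rewrite ler_wpM2r ?expR_ge0// ler_pM ?sqr_ge0 ?powR_ge0//.
    by rewrite H// sqr_ge0.
  have -> : 8 * expR (x ^+ 2 / 8) * (c * expR (8^-1 * v ^+ 2)) *
     expR (x ^+ 2 / 4) = 8 * c * (expR (x ^+ 2 * (3 / 8) + v ^+ 2 / 8)).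
    rewrite (_ : x ^+ 2 * (3 / 8) + v ^+ 2 / 8 =
      x ^+ 2 / 8 + 8^-1 * v ^+ 2 + x ^+ 2 / 4); last by lra.
    by rewrite !expRD; ring.
  rewrite ler_pM2l; last by lra.
  have [xv|/ltW xv] := leP (x ^+ 2) (v ^+ 2).
    apply: ler_wpDl; first exact: expR_ge0.
    by rewrite ler_expR; lra.
  apply: ler_wpDr; first exact: expR_ge0.
  by rewrite ler_expR; lra.
have h2 : h ^+ 2 <= 2 * q ^+ 2 * (x ^+ 2 * (`|y| `^ (q - 1)) ^+ 2 +
    x ^+ 2 * (`|z| `^ (q - 1)) ^+ 2).
  rewrite -real_normK ?num_real//.
  apply: (@le_trans _ _
    ((q * (`|x| * (`|y| `^ (q - 1) + `|z| `^ (q - 1)))) ^+ 2)).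
    by rewrite ler_sqr ?nnegrE//; apply: le_trans hle.
  rewrite !exprMn real_normK ?num_real// -mulrDr mulrA.
  set A := `|y| `^ _; set B := `|z| `^ _.
  have : (A + B) ^+ 2 <= 2 * (A ^+ 2 + B ^+ 2).
    by have := sqr_ge0 (A - B); nra.
  move=> /(ler_wpM2l (mulr_ge0 (sqr_ge0 q) (sqr_ge0 x))); lra.
have {}h2 := ler_wpM2r (expR_ge0 (x ^+ 2 / 4)) h2.
apply: (le_trans h2).
have q2 : 0 <= 2 * q ^+ 2 by rewrite mulr_ge0 ?sqr_ge0.
have := ler_wpM2l q2 (lerD (key y) (key z)).
have c8 : 0 <= 8 * c by lra.
have := mulr_ge0 q2 (mulr_ge0 c8 (expR_ge0 (y ^+ 2 / 2))).
have := mulr_ge0 q2 (mulr_ge0 c8 (expR_ge0 (z ^+ 2 / 2))).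
lra.
Qed.

Lemma convex_powR_sum p (l : R) x y : 1 <= p -> 0 <= l <= 1 -> 0 <= x -> 0 <= y ->
  (l * x + (1 - l) * y) `^ p <= l * x `^ p + (1 - l) * y `^ p.
Proof.
move=> p1 /andP[l0 l1] x0 y0.
have := @convex_powR R p p1 (Itv01 l0 l1) x y.
rewrite !inE/= !in_itv/= !andbT => /(_ x0 y0).
by rewrite !convRE.
Qed.

Lemma powRV x r : 0 <= x -> x^-1 `^ r = (x `^ r)^-1.
Proof.
by move=> x0; rewrite -(powR_inv1 x0) powRAC powR_inv1 ?powR_ge0.
Qed.

(** Triangle inequality in l_p in a form that does not mention p-th roots: convexity of
    the p-th power at the point (x + y) / (A + B), a convex combination of x / A and
    y / B. *)
Lemma minkowski_sum (I : finType) p (x y : I -> R) (A B : R) : 1 <= p ->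
  (forall i, 0 <= x i) -> (forall i, 0 <= y i) -> 0 <= A -> 0 < B ->
  \sum_i x i `^ p <= A `^ p -> \sum_i y i `^ p <= B `^ p ->
  \sum_i (x i + y i) `^ p <= (A + B) `^ p.
Proof.
move=> p1 x0 y0; have p0 : 0 < p by lra.
rewrite le_eqVlt => /predU1P[<- B0|A0 B0 hx hy].
  rewrite powR0 ?gt_eqF// add0r => hx.
  have x00 i : x i = 0.
    apply: (@powR_eq0_eq0 _ _ p); apply/eqP; rewrite eq_le powR_ge0 andbT.
    apply: le_trans hx; rewrite (bigD1 i)//= lerDl sumr_ge0// => j _.
    exact: powR_ge0.
  by under [in X in _ -> X]eq_bigr do rewrite x00 add0r.
have AB0 : 0 < A + B by lra.
set l := A / (A + B).
have l01 : 0 <= l <= 1.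
  by rewrite /l divr_ge0 ?(ltW A0) ?(ltW AB0)//= ler_pdivrMr// mul1r; lra.
have -> : (A + B) `^ p = (A + B) `^ p * l + (A + B) `^ p * (1 - l) by ring.

have step i : (x i + y i) `^ p <=
  (A + B) `^ p * l * (x i `^ p / A `^ p) + (A + B) `^ p * (1 - l) * (y i `^ p / B `^ p).
  have -> : x i + y i = (A + B) * (l * (x i / A) + (1 - l) * (y i / B)).
    by rewrite /l; field; rewrite !gt_eqF.
  have xA : 0 <= x i / A by rewrite divr_ge0// ltW.
  have yB : 0 <= y i / B by rewrite divr_ge0// ltW.
  have /andP[l0 l1] := l01.
  rewrite powRM ?(ltW AB0)//; last first.
    by rewrite addr_ge0// mulr_ge0//; lra.
  rewrite -(mulrA _ l) -(mulrA _ (1 - l)) -mulrDr ler_wpM2l ?powR_ge0//.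
  apply: (le_trans (convex_powR_sum p1 l01 xA yB)).
  by rewrite !powRM ?invr_ge0 ?(ltW A0) ?(ltW B0)// !powRV ?(ltW A0) ?(ltW B0).
apply: (le_trans (ler_sum _ (fun i _ => step i))).
have /andP[l0 l1] := l01.
rewrite big_split/= -!mulr_sumr -!mulr_suml lerD//.
  rewrite ler_piMr//; first by rewrite mulr_ge0 ?powR_ge0.
  by rewrite ler_pdivrMr ?powR_gt0// mul1r.
rewrite ler_piMr//; first by rewrite mulr_ge0 ?powR_ge0//; lra.
by rewrite ler_pdivrMr ?powR_gt0// mul1r.
Qed.

End real_inequalities.

(** * Sums over an independent sample *)

Section product_expectation.
Context {R : realType} {dW dT : measure_display} {W : measurableType dW}
  {T : measurableType dT}.
Variables (P : probability W R) (mu : probability T R).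
Import HBNNSimple.

(** The hypothesis says that the measures B |-> E[Y 1_B(X)] and c mu agree; the
    conclusion, that so do their integrals, is reached through simple functions and
    monotone convergence. *)
Lemma integral_indep_factor (X : W -> T) (Y : W -> R) (c : R) :
  measurable_fun setT X -> measurable_fun setT Y -> (forall w, 0 <= Y w) ->
  (forall B, measurable B ->
    (\int[P]_w (Y w * \1_B (X w))%:E = c%:E * mu B)%E) ->
  forall g : T -> R, measurable_fun setT g -> (forall x, 0 <= g x) ->
    (\int[P]_w (Y w * g (X w))%:E = c%:E * \int[mu]_x (g x)%:E)%E.
Proof.
move=> mX mY Y0 H g mg g0.
have mEg : measurable_fun setT (EFin \o g) by exact/measurable_EFinP.
pose h := nnsfun_approx measurableT mEg.
have hcvg x : (EFin \o h^~ x) @ \oo --> (g x)%:E.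
  by apply: (cvg_nnsfun_approx measurableT mEg) => // y _; rewrite lee_fin.
have hnd x m n : (m <= n)%N -> h m x <= h n x.
  by move=> mn; exact/lefP/nd_nnsfun_approx.
have step n : (\int[P]_w (Y w * h n (X w))%:E = c%:E * \int[mu]_x (h n x)%:E)%E.
  pose s := fset_set (h n @` setT).
  have mB i : measurable (h n @^-1` [set s`_i]) by [].
  have s0 i : (i < #|` s|)%N -> 0 <= s`_i.
    move=> si; have : s`_i \in s by rewrite mem_nth.
    by rewrite /s in_fset_set// inE => -[x _ <-].
  transitivity (\sum_(i < #|` s|)
     (s`_i)%:E * \int[P]_w (Y w * \1_(h n @^-1` [set s`_i]) (X w))%:E)%E.
    under [RHS]eq_bigr => i _.
      rewrite -ge0_integralZl_EFin//; last first.
      - exact: s0.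
      - by apply/measurable_EFinP/measurable_funM => //; exact: measurableT_comp.
      - by move=> w _; rewrite lee_fin mulr_ge0.
      over.
    rewrite -ge0_integral_sum//; last 2 first.
    - move=> i; apply: measurable_funeM; apply/measurable_EFinP.
      by apply: measurable_funM => //; exact: measurableT_comp.
    - by move=> i w _; rewrite mule_ge0// lee_fin ?s0// mulr_ge0.
    apply: eq_integral => w _; rewrite fimfunEord mulr_sumr -sumEFin.
    by apply: eq_bigr => i _; rewrite -EFinM mulrCA.
  under eq_bigr => i _ do rewrite H//.
  under eq_bigr => i _ do rewrite muleCA.
  rewrite -ge0_sume_distrr; last by move=> i _; rewrite mule_ge0// lee_fin s0.
  congr (c%:E * _)%E.
  under [RHS]eq_integral => x _ do rewrite fimfunEord -sumEFin.
  rewrite ge0_integral_sum//; last 2 first.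
  - move=> i; apply/measurable_EFinP.
    by apply: measurable_funM => //; exact: measurable_indic.
  - by move=> i x _; rewrite lee_fin mulr_ge0// s0.
  apply: eq_bigr => i _.
  under eq_integral => x _ do rewrite EFinM.
  rewrite ge0_integralZl_EFin ?s0//; last exact/measurable_EFinP/measurable_indic.
  by rewrite integral_indic// setIT.
have cvgL : (\int[P]_w (Y w * h n (X w))%:E)%E @[n --> \oo] -->
    (\int[P]_w (Y w * g (X w))%:E)%E.
  rewrite [X in _ --> X](_ : _ =
      (\int[P]_w (limn (fun n => (Y w * h n (X w))%:E)))%E); last first.
    apply: eq_integral => w _; apply/esym/cvg_lim => //.
    rewrite EFinM; under eq_fun do rewrite EFinM.
    by apply: cvgeZl => //; exact: hcvg.
  apply: cvg_monotone_convergence => //.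
  - move=> n; apply/measurable_EFinP/measurable_funM => //.
    by apply: measurableT_comp.
  - by move=> n w _; rewrite lee_fin mulr_ge0.
  - by move=> w _ m n mn; rewrite lee_fin ler_wpM2l// hnd.
have cvgR : (\int[mu]_x (h n x)%:E)%E @[n --> \oo] --> (\int[mu]_x (g x)%:E)%E.
  rewrite [X in _ --> X](_ : _ = (\int[mu]_x (limn (fun n => (h n x)%:E)))%E); last first.
    by apply: eq_integral => x _; apply/esym/cvg_lim => //; exact: hcvg.
  apply: cvg_monotone_convergence => //.
  - by move=> n; exact/measurable_EFinP.
  - by move=> n x _; rewrite lee_fin.
  - by move=> x _ m n mn; rewrite lee_fin hnd.
have := cvgeZl (erefl : c%:E \is a fin_num) cvgR.
under eq_fun do rewrite -step.
exact: cvg_unique cvgL.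
Qed.

End product_expectation.

Section independent_sums.
Context {R : realType} {dW dT : measure_display} {W : measurableType dW}
  {T : measurableType dT} (P : probability W R) (mu : probability T R) (N : nat).
Variable X_ : 'I_N -> {RV P >-> T}.
Hypothesis lawX : forall i B, measurable B -> distribution P (X_ i) B = mu B.
Hypothesis indX : independent_RVs P (fun i => X_ i : W -> T).

Let mX i : measurable_fun setT (X_ i : W -> T).
Proof. by []. Qed.

(** Independence is the case where all factors are indicators; the indicators are
    replaced by g one coordinate at a time. *)
Lemma integral_indep_prod (g : T -> R) (a : R) :
  measurable_fun setT g -> (forall x, 0 <= g x) ->
  (\int[mu]_x (g x)%:E = a%:E)%E ->
  (\int[P]_w (\prod_(i < N) g (X_ i w))%:E = (a ^+ N)%:E)%E.
Proof.
move=> mg g0 ga.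
pose F k (B : 'I_N -> set T) w :=
  \prod_(i < N) (if (i < k)%N then g (X_ i w) else \1_(B i) (X_ i w)).
pose v k (B : 'I_N -> set T) :=
  \prod_(i < N) (if (i < k)%N then a else fine (mu (B i))).
suff H k : (k <= N)%N -> forall B, (forall i, measurable (B i)) ->
    (\int[P]_w (F k B w)%:E = (v k B)%:E)%E.
  have := H N (leqnn N) (fun=> setT) (fun=> measurableT).
  rewrite /v (eq_bigr (fun=> a)); last by move=> i _; rewrite ltn_ord.
  rewrite prodr_const card_ord => <-; apply: eq_integral => w _.
  by congr EFin; apply: eq_bigr => i _; rewrite ltn_ord.
elim: k => [_ B mB|k IH kN B mB].
  transitivity (P (\bigcap_(i in [set: 'I_N]) (X_ i @^-1` B i))).
    rewrite -[X in _ = P X]setIT -integral_indic.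
      apply: eq_integral => w _; congr EFin; rewrite /F/=.
      have [h|] := pselect (forall i, B i (X_ i w)).
        rewrite indicE mem_set => [|i _]; last exact: h.
        by apply: big1 => i _; rewrite indicE mem_set.
      move=> /existsNP[i Bi]; rewrite indicE memNset => [|/(_ i Logic.I)]//.
      by rewrite (bigD1 i)//= indicE memNset// mul0r.
    exact: measurableT.
    apply: fin_bigcap_measurable => // i _.
    by rewrite -[X in measurable X]setTI; apply: mX.
  rewrite indX// /v -prodEFin; apply: eq_bigr => i _ /=.
  by rewrite fineK ?fin_num_measure// -(lawX i).
pose i0 := Ordinal kN.
pose Y w := \prod_(i < N | i != i0)
  (if (i < k)%N then g (X_ i w) else \1_(B i) (X_ i w)).
pose c := \prod_(i < N | i != i0) (if (i < k)%N then a else fine (mu (B i))).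
have neq (i : 'I_N) : i != i0 -> (i < k.+1)%N = (i < k)%N.
  by move=> ii0; rewrite ltnS leq_eqVlt -[(i == k :> nat)]/(i == i0) (negbTE ii0).
have -> : v k.+1 B = c * a.
  rewrite /v (bigD1 i0)//= ltnSn mulrC; congr (_ * _).
  by apply: eq_bigr => i /neq ->.
transitivity (\int[P]_w (Y w * g (X_ i0 w))%:E)%E.
  apply: eq_integral => w _; congr EFin.
  rewrite /F (bigD1 i0)//= ltnSn mulrC; congr (_ * _).
  by apply: eq_bigr => i /neq ->.
rewrite EFinM -ga; apply: integral_indep_factor => //.
- rewrite /Y; under eq_fun do rewrite -big_filter.
  apply: measurable_prod => i _; case: (i < k)%N; first exact: measurableT_comp.
  by apply: measurableT_comp => //; exact: measurable_indic.
- by move=> w; apply: prodr_ge0 => i _; case: (i < k)%N.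
move=> C mC; pose B' i := if i == i0 then C else B i.
have := IH (ltnW kN) B' _.
have -> : v k B' = c * fine (mu C).
  rewrite /v (bigD1 i0)//= ltnn mulrC /B' eqxx; congr (_ * _).
  by apply: eq_bigr => i /negbTE ->.
rewrite EFinM fineK ?fin_num_measure// => <-; last first.
  by move=> i; rewrite /B'; case: ifPn.
apply: eq_integral => w _; congr EFin.
rewrite /F (bigD1 i0)//= ltnn mulrC /B' eqxx; congr (_ * _).
by apply: eq_bigr => i /negbTE ->.
Qed.

Lemma measurable_iid_sum (phi : T -> R) : measurable_fun setT phi ->
  measurable_fun setT (fun w => \sum_(i < N) phi (X_ i w)).
Proof.
by move=> mphi; apply: measurable_sum => i; exact: measurableT_comp.
Qed.

Lemma measurable_iid_ge (phi : T -> R) (c : R) : measurable_fun setT phi ->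
  measurable [set w | (c <= \sum_(i < N) phi (X_ i w))%R].
Proof.
move=> /measurable_iid_sum msum; rewrite -[X in measurable X]setTI.
exact: measurable_fun_ler.
Qed.

(** Markov's inequality for the product of the exponentials. *)
Lemma chernoff_iid (phi : T -> R) (b s : R) :
  measurable_fun setT phi ->
  (\int[mu]_x (expR (phi x))%:E <= (expR b)%:E)%E ->
  (P [set w | (N%:R * b + s <= \sum_(i < N) phi (X_ i w))%R] <=
    (expR (- s))%:E)%E.
Proof.
move=> mphi hphi.
have mexp : measurable_fun setT (fun x => expR (phi x)).
  exact: measurableT_comp.
pose a := fine (\int[mu]_x (expR (phi x))%:E)%E.
have i0 : (0 <= \int[mu]_x (expR (phi x))%:E)%E.
  by apply: integral_ge0 => x _; rewrite lee_fin expR_ge0.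
have ia : (\int[mu]_x (expR (phi x))%:E)%E = a%:E.
  by rewrite fineK// ge0_fin_numE//; apply: le_lt_trans hphi _; rewrite ltry.
have a0 : 0 <= a by rewrite -lee_fin -ia.
have ab : a <= expR b by rewrite -lee_fin -ia.
have := integral_indep_prod mexp (fun x => expR_ge0 (phi x)) ia.
set A := [set w | _].
have mA : measurable A by exact: measurable_iid_ge.
move=> H.
have : ((expR (N%:R * b + s))%:E * P A <= (a ^+ N)%:E)%E.
  rewrite -H -[A]setIT -(integral_indic P measurableT mA) -ge0_integralZl_EFin ?expR_ge0//; last first.
    exact/measurable_EFinP/measurable_indic.
  apply: ge0_le_integral => //.
  - by apply: measurable_funeM; exact/measurable_EFinP/measurable_indic.
  - apply/measurable_EFinP; apply: measurable_prod => i _.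
    exact: (measurableT_comp mexp (mX i)).
  move=> w _; rewrite -EFinM lee_fin -expR_sum indicE.
  case: (boolP (w \in A)) => [/set_mem wA|_]; last by rewrite mulr0 expR_ge0.
  by rewrite mulr1 ler_expR.
rewrite -(@fineK _ (P A)) ?fin_num_measure// -EFinM !lee_fin => h.
rewrite -(ler_pM2l (expR_gt0 (N%:R * b + s))) (le_trans h)//.
rewrite -expRD addrK expRM_natl.
by rewrite lerXn2r ?nnegrE ?expR_ge0.
Qed.

End independent_sums.

(** * Exponential moments of sub-Gaussian functions *)

(** The constant [C1] is kept apart from the scale [delta], so that enlarging [delta]
    weakens the property. *)
Definition subgaussian_tail {R : realType} (C1 : R) {d} {T : measurableType d}
    (mu : probability T R) (g : T -> R) (delta : R) : Prop :=
  forall u, 0 < u ->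
    (mu [set x | (u <= `|g x|)%R] <= (C1 * expR (- (u ^+ 2 / delta ^+ 2)))%:E)%E.

Section moments.
Context {R : realType}.

Lemma sum_geometric_le (r : R) n : 0 <= r < 1 ->
  \sum_(0 <= k < n) r ^+ k <= (1 - r)^-1.
Proof.
move=> /andP[r0 r1].
have : (1 - r) * \sum_(0 <= k < n) r ^+ k = 1 - r ^+ n.
  elim: n => [|n IH]; first by rewrite big_nil mulr0 expr0 subrr.
  by rewrite big_nat_recr//= mulrDr IH exprS; ring.
move=> h; rewrite -[leRHS]mul1r ler_pdivlMr ?subr_gt0// mulrC h.
by rewrite gerBl exprn_ge0.
Qed.

(** Layers of unit width: with Z = (g / delta)^2, exp(Z/2) is at most the sum over
    integers k of exp((k+1)/2) on the event Z >= k, which has probability at most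
    C1 exp(-k). *)
Lemma subgaussian_expR_sqr (C1 : R) : 1 < C1 ->
  exists2 B : R, 1 <= B & forall d (T : measurableType d) (mu : probability T R)
    (g : T -> R) (delta : R), measurable_fun setT g -> 0 < delta ->
    subgaussian_tail C1 mu g delta ->
    (\int[mu]_x (expR ((g x / delta) ^+ 2 / 2))%:E <= B%:E)%E.
Proof.
move=> hC1; pose r : R := expR (- 2^-1).
have r01 : 0 <= r < 1 by rewrite /r expR_ge0/= expR_lt1; lra.
have r'0 : 0 < (1 - r)^-1 by case/andP: r01 => r0 r1; rewrite invr_gt0; lra.
have e1 : 1 < expR (2^-1 : R) by rewrite expR_gt1.
exists (C1 * expR (2^-1) * (1 - r)^-1).
  have r1 : 1 <= (1 - r)^-1.
    by case/andP: r01 => r0 r1; rewrite invf_ge1; lra.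
  by rewrite -[leLHS]mulr1 ler_pM// -[leLHS]mulr1 ler_pM//; lra.
move=> d T mu g delta mg delta0 sg.
pose z x := (g x / delta) ^+ 2.
have mz : measurable_fun setT z.
  by apply: measurable_funX; apply: measurable_funM.
have z0 x : 0 <= z x by rewrite sqr_ge0.
pose A k := [set x | k%:R <= z x].
have mA k : measurable (A k).
  by rewrite /A -[X in measurable X]setTI; exact: measurable_fun_ler.
have muA k : (mu (A k) <= (C1 * expR (- k%:R))%:E)%E.
  case: k => [|k].
    rewrite oppr0 expR0 mulr1 (le_trans (probability_le1 _ (mA _)))//.
    by rewrite lee_fin ltW.
  have s0 : 0 < Num.sqrt (k.+1%:R : R) by rewrite sqrtr_gt0.
  have -> : A k.+1 = [set x | (delta * Num.sqrt k.+1%:R) <= `|g x|].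
    apply/funext => x; rewrite /A /z /=.
    rewrite -[in RHS]ler_sqr ?nnegrE ?(mulr_ge0 (ltW delta0))// [in RHS]exprMn sqr_sqrtr//.
    rewrite real_normK ?num_real// expr_div_n.
    by rewrite ler_pdivlMr ?exprn_gt0// mulrC.
  have := sg _ (mulr_gt0 delta0 s0).
  by rewrite exprMn sqr_sqrtr// mulrAC divff ?mul1r// gt_eqF ?exprn_gt0.
pose f k x : \bar R := ((expR (k.+1%:R / 2)) * \1_(A k) x)%:E.
have mf k : measurable_fun setT (f k).
  by apply/measurable_EFinP/measurable_funM => //; exact: measurable_indic.
have f0 k x : (0 <= f k x)%E by rewrite lee_fin mulr_ge0 ?expR_ge0.
apply: (@le_trans _ _ (\int[mu]_x (\sum_(0 <= k <oo) f k x))%E).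
  apply: ge0_le_integral => //.
  - apply/measurable_EFinP; apply: measurableT_comp => //.
    by apply: measurable_funM.
  - by apply: ge0_emeasurable_sum.
  move=> x _; pose k := Num.truncn (z x).
  have /andP[kz zk] : k%:R <= z x < k.+1%:R by exact: truncn_itv.
  apply: (@le_trans _ _ (\sum_(0 <= i < k.+1) f i x)%E); last exact: nneseries_lim_ge.
  rewrite big_nat_recr//= /f indicE mem_set// mulr1.
  rewrite -[leLHS]add0e leeD//; first exact: sume_ge0.
  by rewrite lee_fin ler_expR -/(z x); lra.
rewrite integral_nneseries//.
apply: lime_le.
  by apply: is_cvg_nneseries => n _ _; apply: integral_ge0.
apply: nearW => n.
apply: (@le_trans _ _ (\sum_(0 <= k < n) (C1 * expR 2^-1 * r ^+ k)%:E)%E).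
  apply: lee_sum => k _; rewrite /f.
  under eq_integral do rewrite EFinM.
  rewrite ge0_integralZl_EFin ?expR_ge0//; last exact/measurable_EFinP/measurable_indic.
  rewrite integral_indic// setIT.
  apply: (@le_trans _ _ ((expR (k.+1%:R / 2))%:E * (C1 * expR (- k%:R))%:E)%E).
    by apply: lee_wpmul2l; [rewrite lee_fin expR_ge0|exact: muA].
  rewrite -EFinM lee_fin mulrCA -mulrA ler_pM2l; last lra.
  rewrite /r -expRM_natl -!expRD ler_expR -natr1; lra.
rewrite sumEFin lee_fin -mulr_sumr ler_pM2l ?sum_geometric_le//.
by rewrite mulr_gt0 ?expR_gt0//; lra.
Qed.

End moments.

Section exponential_moments.
Context {R : realType} {d : measure_display} {T : measurableType d}
  (mu : probability T R).
Implicit Types (h z Y : T -> R) (V l : R).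

Lemma integral_le_expR (e Y : T -> R) (V c : R) :
  measurable_fun setT e -> measurable_fun setT Y ->
  (forall x, 0 <= e x <= 1 + c * Y x) -> 0 <= c -> (forall x, 0 <= Y x) ->
  (\int[mu]_x (Y x)%:E <= V%:E)%E ->
  (\int[mu]_x (e x)%:E <= (expR (c * V))%:E)%E.
Proof.
move=> me mY he c0 Y0 YV.
apply: (@le_trans _ _ (\int[mu]_x (1%:E + c%:E * (Y x)%:E))%E).
  apply: ge0_le_integral => //.
  - by move=> x _; rewrite lee_fin; case/andP: (he x).
  - exact/measurable_EFinP.
  - by apply: emeasurable_funD => //; apply: measurable_funeM; exact/measurable_EFinP.
  - by move=> x _; rewrite -EFinM -EFinD lee_fin; case/andP: (he x).
rewrite ge0_integralD//; last 2 first.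
- by move=> x _; rewrite -EFinM lee_fin mulr_ge0.
- by apply: measurable_funeM; exact/measurable_EFinP.
rewrite (integral_cst mu measurableT) [X in (_ * X)%E]probability_setT mule1 ge0_integralZl_EFin//; last exact/measurable_EFinP.
apply: (@le_trans _ _ (1%:E + c%:E * V%:E)%E).
  by rewrite leeD2l// lee_wpmul2l.
  by rewrite -EFinM -EFinD lee_fin expR_ge1Dx.
by move=> x _; rewrite lee_fin.
Qed.

Lemma integrable_sqr_le h Y V : measurable_fun setT h -> measurable_fun setT Y ->
  (forall x, h x ^+ 2 <= Y x) -> (\int[mu]_x (Y x)%:E <= V%:E)%E ->
  mu.-integrable setT (EFin \o h).
Proof.
move=> mh mY hY YV.
have Y0 x : 0 <= Y x by apply: le_trans (hY x); exact: sqr_ge0.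
have iY : mu.-integrable setT (EFin \o Y).
  apply/integrableP; split; first exact/measurable_EFinP.
  apply: le_lt_trans (ltry V); apply: le_trans YV.
  under eq_integral => x _ do rewrite /= ger0_norm//.
  by [].
have i1 : mu.-integrable setT (cst 1%:E) by exact: finite_measure_integrable_cst.
apply: (le_integrable _ _ _ (integrableD _ i1 iY)) => //.
  exact/measurable_EFinP.
move=> x _ /=; rewrite lee_fin (@ger0_norm _ (1 + Y x)); last by rewrite addr_ge0.
have := hY x; rewrite -(real_normK (num_real (h x))) => hx.
by have := sqr_ge0 (`|h x| - 1); have := normr_ge0 (h x); nra.
Qed.

(** This replaces Bernstein's inequality: the truncation at 1 / |l| is invisible in the
    mean on the right, see [expR_truncated]. *)
Lemma truncated_mgf h Y V l : measurable_fun setT h -> measurable_fun setT Y ->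
  (forall x, h x ^+ 2 <= Y x) -> (\int[mu]_x (Y x)%:E <= V%:E)%E ->
  (\int[mu]_x (expR (if (`|l * h x| <= 1)%R then l * h x else 0))%:E <=
    (expR (l * \int[mu]_x h x + 2 * l ^+ 2 * V))%:E)%E.
Proof.
move=> mh mY hY YV.
have Y0 x : 0 <= Y x by apply: le_trans (hY x); exact: sqr_ge0.
have ih := integrable_sqr_le mh mY hY YV.
have iY : mu.-integrable setT (EFin \o Y).
  apply/integrableP; split; first exact/measurable_EFinP.
  apply: le_lt_trans (ltry V); apply: le_trans YV.
  under eq_integral => x _ do rewrite /= ger0_norm//.
  by [].
have i1 : mu.-integrable setT (cst 1%:E) by exact: finite_measure_integrable_cst.
pose G x := 1 + l * h x + 2 * l ^+ 2 * Y x.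
have GE : (EFin \o G) = ((cst 1%:E \+ (fun x => l%:E * (EFin \o h) x))
    \+ (fun x => (2 * l ^+ 2)%:E * (EFin \o Y) x))%E.
  by apply/funext => x; rewrite /G /= -!EFinM -!EFinD.
have ilh := integrableZl measurableT l ih.
have ilY := integrableZl measurableT (2 * l ^+ 2) iY.
have iG : mu.-integrable setT (EFin \o G).
  by rewrite GE; do 2 apply: integrableD => //.
have mG : measurable_fun setT G by exact/measurable_EFinP/(measurable_int _ iG).
have hG x : expR (if `|l * h x| <= 1 then l * h x else 0) <= G x.
  apply: le_trans (expR_truncated _) _.
  rewrite /G lerD2l -mulrA ler_pM2l// exprMn.
  by rewrite ler_wpM2l ?sqr_ge0.
apply: (@le_trans _ _ (\int[mu]_x (G x)%:E)%E).
  apply: ge0_le_integral => //.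
  - by move=> x _; rewrite lee_fin expR_ge0.
  - apply/measurable_EFinP; apply: measurableT_comp => //.
    apply: measurable_fun_if => //.
    + apply: measurable_fun_ler => //; apply: measurableT_comp => //.
      exact: measurable_funM.
    + exact: measurable_funTS (measurable_funM _ _).
  - exact/measurable_EFinP.
  - by move=> x _; rewrite lee_fin.
rewrite [leLHS](_ : _ = \int[mu]_x ((EFin \o G) x))%E// GE.
rewrite integralD//; last exact: integrableD.
rewrite integralD// (integral_cst mu measurableT) [X in (_ * X)%E]probability_setT mule1.
rewrite !integralZl//.
have -> : (\int[mu]_x (EFin \o h) x)%E = (\int[mu]_x h x)%R%:E.
  by rewrite /Rintegral fineK//; exact: integrable_fin_num.
apply: (@le_trans _ _ (1%:E + l%:E * (\int[mu]_x h x)%R%:E + (2 * l ^+ 2)%:E * V%:E)%E).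
  by rewrite leeD2l// lee_wpmul2l// lee_fin mulr_ge0// sqr_ge0.
by rewrite -!EFinM -!EFinD lee_fin -addrA expR_ge1Dx.
Qed.

(** The event |l h| > 1 is charged to the factor (l h)^2, which exceeds 1 there; thus the
    exponential moment differs from 1 by a term of order l^2 only. *)
Lemma large_part_mgf h z Y V l : measurable_fun setT h -> measurable_fun setT z ->
  measurable_fun setT Y -> (forall x, h x ^+ 2 * expR (z x ^+ 2 / 4) <= Y x) ->
  (\int[mu]_x (Y x)%:E <= V%:E)%E ->
  (\int[mu]_x (expR (if (`|l * h x| <= 1)%R then 0 else z x ^+ 2 / 4))%:E <=
    (expR (l ^+ 2 * V))%:E)%E.
Proof.
move=> mh mz mY hY; apply: integral_le_expR => //; last 2 first.
- exact: sqr_ge0.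
- by move=> x; apply: le_trans (hY x); rewrite mulr_ge0 ?sqr_ge0 ?expR_ge0.
- apply: measurableT_comp => //; apply: measurable_fun_if => //.
  + apply: measurable_fun_ler => //; apply: measurableT_comp => //.
    exact: measurable_funM.
  + apply: measurable_funTS; apply: measurable_funM => //.
    exact: measurable_funX.
move=> x; rewrite expR_ge0/=.
have h2 := ler_wpM2l (sqr_ge0 l) (hY x).
have l2 := mulr_ge0 (sqr_ge0 l) (mulr_ge0 (sqr_ge0 (h x)) (expR_ge0 (z x ^+ 2 / 4))).
case: ifPn => [_|]; first by rewrite expR0 lerDl; lra.
rewrite -ltNge => lh.
have : 1 <= (l * h x) ^+ 2.
  by rewrite -real_normK ?num_real// exprn_ege1// ltW.
rewrite exprMn => /(ler_wpM2r (expR_ge0 (z x ^+ 2 / 4))).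
rewrite mul1r -(mulrA (l ^+ 2)) => /le_trans; apply; apply: (le_trans h2).
by rewrite lerDr.
Qed.

Lemma minimum_mgf z Y V (p c : R) : measurable_fun setT z -> measurable_fun setT Y ->
  0 <= c -> (forall x, `|z x| `^ p * expR (z x ^+ 2 / 4) <= Y x) ->
  (\int[mu]_x (Y x)%:E <= V%:E)%E ->
  (\int[mu]_x (expR (Num.min (c * `|z x| `^ p) (z x ^+ 2 / 4)))%:E <=
    (expR (4 * c * V))%:E)%E.
Proof.
move=> mz mY c0 hY; apply: integral_le_expR => //; last 2 first.
- by rewrite mulr_ge0.
- by move=> x; apply: le_trans (hY x); rewrite mulr_ge0 ?powR_ge0 ?expR_ge0.
- apply: measurableT_comp => //; apply: measurable_minr; apply: measurable_funM => //.
  + apply: (measurableT_comp (measurable_powR p)); exact: measurableT_comp.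
  + exact: measurable_funX.
move=> x; rewrite expR_ge0/=.
have cp0 : 0 <= c * `|z x| `^ p by rewrite mulr_ge0 ?powR_ge0.
apply: (le_trans (expR_min _ cp0)).
have h2 := ler_wpM2l c0 (hY x).
have e1 : 1 <= expR (z x ^+ 2 / 4).
  by have := expR_ge1Dx (z x ^+ 2 / 4); have := sqr_ge0 (z x); lra.
have := ler_wpM2l cp0 e1; lra.
Qed.

End exponential_moments.

(** * Sums recovered from their truncations *)

Section finite_sums.
Context {R : realType} (I : finType).

(** Each x_i^r is x_i times x_i^(r-1), and x_i is at most the whole sum. *)
Lemma sum_powR_le (x : I -> R) r : 1 <= r -> (forall i, 0 <= x i) ->
  \sum_i x i `^ r <= (\sum_i x i) `^ r.
Proof.
move=> r1 x0; have r0 : 0 < r by lra.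
have s0 : 0 <= \sum_i x i by exact: sumr_ge0.
rewrite -(mulr_powRB1 s0 r0) mulr_suml; apply: ler_sum => i _.
rewrite -(mulr_powRB1 (x0 i) r0) ler_wpM2l// ge0_ler_powR ?nnegrE//; first lra.
by rewrite (bigD1 i)//= lerDl sumr_ge0.
Qed.

(** Deterministic half of the estimate for one link.  In the application t and n are
    the square roots of the level and of the sample size, h is the normalized
    increment with mean m, and A and B are the normalized (q-1)-st powers of the two
    functions.  The first two hypotheses on the truncations control the small values
    of h; the third one bounds the sum of z^2 over the indices of the large values,
    where |h| is compared with |z| (A + B). *)
Lemma sum_le_of_truncations (h z A B : I -> R) (m t n V s q : R) :
  1 <= q -> 0 < t -> 0 < n -> 0 < s -> 1 <= V ->
  (forall i, 0 <= A i) -> (forall i, 0 <= B i) ->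
  (forall i, `|h i| <= q * (`|z i| * (A i + B i))) ->
  \sum_i A i ^+ 2 <= s ^+ 2 -> \sum_i B i ^+ 2 <= s ^+ 2 ->
  let l := t / n in
  \sum_i (if `|l * h i| <= 1 then l * h i else 0) <=
    n ^+ 2 * (l * m + 2 * l ^+ 2 * V) + 6 * t ^+ 2 ->
  \sum_i (if `|- l * h i| <= 1 then - l * h i else 0) <=
    n ^+ 2 * (- l * m + 2 * (- l) ^+ 2 * V) + 6 * t ^+ 2 ->
  \sum_i (if `|l * h i| <= 1 then 0 else z i ^+ 2 / 4) <=
    n ^+ 2 * (l ^+ 2 * V) + 6 * t ^+ 2 ->
  `|\sum_i h i - n ^+ 2 * m| <= q * (4 * V + 25) * (t * (n + s)).
Proof.
move=> q1 t0 n0 s0 V1 A0 B0 hh sA sB l h1 h2 h3.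
have l0 : 0 < l by rewrite divr_gt0.
have ln : l * n = t by rewrite /l divfK ?gt_eqF.
have n2l2 : n ^+ 2 * l ^+ 2 = t ^+ 2 by rewrite -ln; ring.
pose big i := ~~ (`|l * h i| <= 1).
have bigE (F : I -> R) : \sum_i (if `|l * h i| <= 1 then 0 else F i) = \sum_(i | big i) F i.
  rewrite [RHS]big_mkcond; apply: eq_bigr => i _; rewrite /big.
  by case: ifPn => //; rewrite negbK.
have smallE (F : I -> R) : \sum_i F i =
    \sum_i (if `|l * h i| <= 1 then F i else 0) + \sum_(i | big i) F i.
  by rewrite -bigE -big_split/=; apply: eq_bigr => i _; case: ifPn => _; rewrite ?addr0 ?add0r.
set L := \sum_(i | big i) `|h i|.
have zA (C : I -> R) : (forall i, 0 <= C i) -> \sum_i C i ^+ 2 <= s ^+ 2 ->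
    \sum_(i | big i) `|z i| * C i <= s * t * (2 * V + 25 / 2).
  move=> C0 sC.
  have hz : \sum_(i | big i) z i ^+ 2 <= 4 * (V + 6) * t ^+ 2.
    move: h3; rewrite bigE -mulr_suml mulrA n2l2 ler_pdivrMr//; lra.
  have st0 : 0 < s / t by rewrite divr_gt0.
  (* The weight s / t equates the two sums of the arithmetic-geometric mean inequality. *)
  apply: (@le_trans _ _ (\sum_(i | big i) (s / t * z i ^+ 2 + t / s * C i ^+ 2) / 2)).
    apply: ler_sum => i _; rewrite ler_pdivlMr//.
    have := sqr_ge0 (`|z i| * (s / t) - C i).
    rewrite -(@pmulr_rge0 _ (t / s)) ?divr_gt0//.
    rewrite -[z i ^+ 2](real_normK (num_real (z i))).
    have -> : t / s * (`|z i| * (s / t) - C i) ^+ 2 = s / t * `|z i| ^+ 2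
        + t / s * C i ^+ 2 - `|z i| * C i * 2.
      by field; rewrite !gt_eqF.
    lra.
  rewrite -mulr_suml big_split/= -!mulr_sumr.
  have sC' : \sum_(i | big i) C i ^+ 2 <= s ^+ 2.
    apply: le_trans sC; rewrite [leRHS](bigID big)/= lerDl.
    by apply: sumr_ge0 => i _; rewrite sqr_ge0.
  have e1 : s / t * \sum_(i | big i) z i ^+ 2 <= s * t * (4 * (V + 6)).
    apply: le_trans (ler_wpM2l (ltW st0) hz) _.
    have -> : s / t * (4 * (V + 6) * t ^+ 2) = s * t * (4 * (V + 6)).
      by field; rewrite gt_eqF.
    exact: lexx.
  have e2 : t / s * \sum_(i | big i) C i ^+ 2 <= s * t.
    apply: le_trans (ler_wpM2l _ sC') _; first by rewrite ltW// divr_gt0.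
    have -> : t / s * s ^+ 2 = s * t by field; rewrite gt_eqF.
    exact: lexx.
  lra.
have hL : L <= q * (s * t * (4 * V + 25)).
  apply: (@le_trans _ _ (q * (\sum_(i | big i) `|z i| * A i + \sum_(i | big i) `|z i| * B i))).
    rewrite -big_split/= mulr_sumr; apply: ler_sum => i _.
    by rewrite -mulrDr.
  rewrite ler_pM2l; last lra.
  by have := zA A A0 sA; have := zA B B0 sB; lra.
have hb : `|\sum_(i | big i) h i| <= L by exact: ler_norm_sum.
pose Sm := \sum_i (if `|l * h i| <= 1 then h i else 0).
have hS : \sum_i h i = Sm + \sum_(i | big i) h i by rewrite smallE.
have e1 : l * Sm <= n ^+ 2 * (l * m + 2 * l ^+ 2 * V) + 6 * t ^+ 2.
  apply: le_trans h1; rewrite mulr_sumr; apply: ler_sum => i _.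
  by case: ifPn => //; rewrite mulr0.
have e2 : - l * Sm <= n ^+ 2 * (- l * m + 2 * l ^+ 2 * V) + 6 * t ^+ 2.
  rewrite sqrrN in h2; apply: le_trans h2; rewrite mulr_sumr; apply: ler_sum => i _.
  by rewrite !mulNr normrN; case: ifPn => // _; rewrite mulr0 oppr0.
have e3 : `|Sm - n ^+ 2 * m| <= t * n * (2 * V + 6).
  rewrite -(ler_pM2l l0) -{1}(gtr0_norm l0) -normrM.
  have -> : l * (t * n * (2 * V + 6)) = 2 * (n ^+ 2 * l ^+ 2) * V + 6 * t ^+ 2.
    by rewrite n2l2 -ln; ring.
  by rewrite ler_norml; apply/andP; split; lra.
have -> : \sum_i h i - n ^+ 2 * m = (Sm - n ^+ 2 * m) + \sum_(i | big i) h i.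
  by rewrite hS; ring.
apply: (le_trans (ler_normD _ _)).
apply: (le_trans (lerD e3 (le_trans hb hL))).
have tn : 0 <= t * n by rewrite mulr_ge0 ?ltW.
have -> : q * (4 * V + 25) * (t * (n + s)) =
  t * n * (q * (4 * V + 25)) + q * (s * t * (4 * V + 25)) by ring.
by rewrite lerD2r ler_wpM2l//; nra.
Qed.

(** An index contributes to the minimum either through its p-th power or through its
    square; in the second case the l_p norm is dominated by the l_2 norm, because
    2 <= p. *)
Lemma sum_powR_of_min (z : I -> R) (p n t M : R) : 2 <= p -> 0 < n -> 0 < t ->
  1 <= M -> n <= t `^ (p / 2) ->
  \sum_i Num.min (t / n * `|z i| `^ p) (z i ^+ 2 / 4) <= M * t ->
  \sum_i `|z i| `^ p <= (4 * M * Num.sqrt t) `^ p.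
Proof.
move=> p2 n0 t0 M1 nt hM.
have p21 : 1 <= p / 2 by lra.
pose f i := Num.min (t / n * `|z i| `^ p) (z i ^+ 2 / 4).
have tn0 : 0 < t / n by rewrite divr_gt0.
have f0 i : 0 <= f i.
  by rewrite le_min (mulr_ge0 (ltW tn0) (powR_ge0 _ _)) divr_ge0 ?sqr_ge0.
have step i : `|z i| `^ p <= n / t * f i + 4 `^ (p / 2) * f i `^ (p / 2).
  have [h|h] := leP (t / n * `|z i| `^ p) (z i ^+ 2 / 4).
    rewrite /f (min_idPl h) mulrA (_ : n / t * (t / n) = 1) ?mul1r; last first.
      by field; rewrite !gt_eqF.
    by rewrite lerDl mulr_ge0 ?powR_ge0.
  have -> : f i = z i ^+ 2 / 4 by rewrite /f; apply/min_idPr; exact: ltW.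
  rewrite -powRM ?divr_ge0 ?sqr_ge0// [4 * _]mulrC divfK//.
  have -> : (z i ^+ 2) `^ (p / 2) = `|z i| `^ p.
    rewrite -(real_normK (num_real (z i))) -powR_mulrn// -powRrM; congr (_ `^ _); lra.
  rewrite lerDr mulr_ge0//; first by rewrite divr_ge0 ?(ltW n0) ?(ltW t0).
  by rewrite divr_ge0 ?sqr_ge0.
apply: (le_trans (ler_sum _ (fun i _ => step i))).
rewrite big_split/= -!mulr_sumr.
have T0 : 0 < t `^ (p / 2) by rewrite powR_gt0.
have e1 : n / t * \sum_i f i <= M * t `^ (p / 2).
  apply: le_trans (ler_wpM2l _ hM) _; first by rewrite ltW// divr_gt0.
  have -> : n / t * (M * t) = M * n by field; rewrite gt_eqF.
  by rewrite ler_pM2l//; lra.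
have e2 : 4 `^ (p / 2) * \sum_i f i `^ (p / 2) <= (4 * M) `^ (p / 2) * t `^ (p / 2).
  rewrite -powRM; [|lra|exact: ltW].
  rewrite -mulrA [leRHS]powRM//; last by rewrite mulr_ge0 ?(ltW t0)//; lra.
  rewrite ler_pM2l ?powR_gt0//; apply: (le_trans (sum_powR_le p21 f0)).
  rewrite ge0_ler_powR ?nnegrE//; first lra.
    exact: sumr_ge0.
  by rewrite mulr_ge0 ?(ltW t0)//; lra.
apply: (le_trans (lerD e1 e2)).
have M4 : 4 <= 4 * M by lra.
have M40 : 0 <= 4 * M by lra.
rewrite [leRHS]powRM ?sqrtr_ge0// -(powR12_sqrt (ltW t0)) -powRrM (mulrC 2^-1).
rewrite -mulrDl ler_pM2r//.
have P4 : 4 * M <= (4 * M) `^ (p / 2) by rewrite le1r_powR//; lra.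
have -> : (4 * M) `^ p = (4 * M) `^ (p / 2) * (4 * M) `^ (p / 2).
  rewrite -powRD; last by apply/implyP => _; rewrite gt_eqF//; lra.
  by congr (_ `^ _); lra.
nra.
Qed.

End finite_sums.

(** * Tail bounds for a single link *)

Definition iid_sample {R : realType} {dW dT : measure_display}
    {W : measurableType dW} {T : measurableType dT} (P : probability W R)
    (mu : probability T R) (N : nat) (X_ : 'I_N -> {RV P >-> T}) : Prop :=
  (forall i B, measurable B -> distribution P (X_ i) B = mu B) /\
  independent_RVs P (fun i => X_ i : W -> T).

Section links.
Context {R : realType} (C1 : R).
Hypothesis hC1 : 1 < C1.

Lemma measurable_abs_powR d (T : measurableType d) (f : T -> R) (q : R) :
  measurable_fun setT f -> measurable_fun setT (fun x => `|f x| `^ q).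
Proof.
move=> mf; apply: (measurableT_comp (measurable_powR q)).
exact: measurableT_comp.
Qed.

(** Normalizing by delta and D makes all exponential moments depend on C1 and q only. *)
Lemma normalized_increment q (x y delta D : R) : 1 <= q -> 0 < delta -> 0 < D ->
  `|(`|x| `^ q - `|y| `^ q) / (delta * D `^ (q - 1))| <=
  q * (`|(x - y) / delta| * (`|x / D| `^ (q - 1) + `|y / D| `^ (q - 1))).
Proof.
move=> q1 delta0 D0.
have DD0 : 0 < D `^ (q - 1) by rewrite powR_gt0.
have powE v : `|v / D| `^ (q - 1) = `|v| `^ (q - 1) / D `^ (q - 1).
  by rewrite normrM normfV (gtr0_norm D0) powRM ?invr_ge0 ?(ltW D0)// powRV// ltW.
rewrite !powE normrM (gtr0_norm (_ : 0 < (delta * _)^-1)); last first.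
  by rewrite invr_gt0 mulr_gt0.
rewrite ler_pdivrMr ?mulr_gt0//.
apply: (le_trans (powR_diff q1 (normr_ge0 x) (normr_ge0 y))).
rewrite normrM normfV (gtr0_norm delta0).
have -> : q * (`|x - y| / delta * (`|x| `^ (q - 1) / D `^ (q - 1) +
     `|y| `^ (q - 1) / D `^ (q - 1))) * (delta * D `^ (q - 1)) =
   q * (`|x - y| * (`|x| `^ (q - 1) + `|y| `^ (q - 1))).
  by field; rewrite !gt_eqF.
rewrite ler_wpM2l//; first lra.
by rewrite ler_wpM2r// ler_dist_dist.
Qed.

(** One dominating function [Y] serves the truncated part, the large part and
    integrability. *)
Lemma increment_moment (q : R) : 1 <= q -> exists2 V : R, 1 <= V &
  forall d (T : measurableType d) (mu : probability T R) (a b : T -> R) (delta D : R),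
  measurable_fun setT a -> measurable_fun setT b -> 0 < delta -> 0 < D ->
  subgaussian_tail C1 mu (fun x => a x - b x) delta ->
  subgaussian_tail C1 mu a D -> subgaussian_tail C1 mu b D ->
  exists Y : T -> R, [/\ measurable_fun setT Y,
    (\int[mu]_x (Y x)%:E <= V%:E)%E &
    forall x, ((`|a x| `^ q - `|b x| `^ q) / (delta * D `^ (q - 1))) ^+ 2 *
              expR (((a x - b x) / delta) ^+ 2 / 4) <= Y x].
Proof.
move=> q1; have [B B1 HB] := subgaussian_expR_sqr hC1.
have [c c1 Hc] := increment_expR_sqr q1.
exists (c * (B + B + B)); first by rewrite -[leLHS]mulr1 ler_pM//; lra.
move=> d T mu a b delta D ma mb delta0 D0 sab sa sb.
have mab : measurable_fun setT (fun x => a x - b x) by exact: measurable_funB.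
pose E (f : T -> R) (s : R) x := expR ((f x / s) ^+ 2 / 2).
have mE f s : measurable_fun setT f -> measurable_fun setT (E f s).
  move=> mf; apply: measurableT_comp => //; apply: measurable_funM => //.
  by apply: measurable_funX; exact: measurable_funM.
exists (fun x => c * (E (fun x => a x - b x) delta x + E a D x + E b D x)); split.
- apply: measurable_funM => //; apply: measurable_funD; last exact: mE.
  by apply: measurable_funD; exact: mE.
- have iE f s : (0 <= \int[mu]_x (E f s x)%:E)%E.
    by apply: integral_ge0 => x _; rewrite lee_fin expR_ge0.
  under eq_integral do rewrite EFinM !EFinD.
  rewrite ge0_integralZl_EFin; last 4 first.
  - exact: measurableT.
  - by move=> x _; rewrite -!EFinD lee_fin !addr_ge0 ?expR_ge0.
  - by do 2?apply: emeasurable_funD; apply/measurable_EFinP; exact: mE.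
  - lra.
  rewrite ge0_integralD//; last 4 first.
  - by move=> x _; rewrite -EFinD lee_fin addr_ge0 ?expR_ge0.
  - by apply: emeasurable_funD; apply/measurable_EFinP; exact: mE.
  - by move=> x _; rewrite lee_fin expR_ge0.
  - by apply/measurable_EFinP; exact: mE.
  rewrite ge0_integralD//; last 4 first.
  - by move=> x _; rewrite lee_fin expR_ge0.
  - by apply/measurable_EFinP; exact: mE.
  - by move=> x _; rewrite lee_fin expR_ge0.
  - by apply/measurable_EFinP; exact: mE.
  rewrite EFinM lee_wpmul2l// ?lee_fin; first lra.
  rewrite !EFinD leeD// ?leeD//.
  + exact: HB.
  + exact: HB.
  + exact: HB.
by move=> x; apply: Hc; exact: normalized_increment.
Qed.


Lemma subgaussian_tail0 d (T : measurableType d) (mu : probability T R) (D : R) :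
  subgaussian_tail C1 mu (fun=> 0) D.
Proof.
move=> u u0; rewrite [X in mu X](_ : _ = set0).
  by rewrite measure0 lee_fin mulr_ge0 ?expR_ge0// (le_trans ler01 (ltW hC1)).
by apply/seteqP; split => x //=; rewrite normr0 leNgt u0.
Qed.

Lemma sqr_le_of_expR (Y h z : R) : h ^+ 2 * expR (z ^+ 2 / 4) <= Y -> h ^+ 2 <= Y.
Proof.
apply: le_trans; rewrite ler_peMr ?sqr_ge0//.
by have := expR_ge1Dx (z ^+ 2 / 4); have := sqr_ge0 z; lra.
Qed.

Lemma integrable_powR_increment (q : R) d (T : measurableType d) (mu : probability T R)
    (a b : T -> R) (delta D : R) : 1 <= q ->
  measurable_fun setT a -> measurable_fun setT b -> 0 < delta -> 0 < D ->
  subgaussian_tail C1 mu (fun x => a x - b x) delta ->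
  subgaussian_tail C1 mu a D -> subgaussian_tail C1 mu b D ->
  mu.-integrable setT (EFin \o (fun x => `|a x| `^ q - `|b x| `^ q)).
Proof.
move=> q1 ma mb delta0 D0 sab sa sb.
have [V _ /(_ d T mu a b delta D)[]// Y [mY YV hY]] := increment_moment q1.
pose h x := (`|a x| `^ q - `|b x| `^ q) / (delta * D `^ (q - 1)).
have mh : measurable_fun setT h.
  apply: measurable_funM => //.
  by apply: measurable_funB; exact: measurable_abs_powR.
have ih := integrable_sqr_le mh mY (fun x => sqr_le_of_expR (hY x)) YV.
have dD0 : 0 < delta * D `^ (q - 1) by rewrite mulr_gt0 ?powR_gt0.
rewrite (_ : EFin \o _ = (fun x => (delta * D `^ (q - 1))%:E * (EFin \o h) x)%E).
  exact: integrableZl.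
by apply/funext => x /=; rewrite -EFinM /h mulrC divfK ?gt_eqF.
Qed.

Lemma integrable_powR (q : R) d (T : measurableType d) (mu : probability T R)
    (a : T -> R) (D : R) : 1 <= q -> measurable_fun setT a -> 0 < D ->
  subgaussian_tail C1 mu a D ->
  mu.-integrable setT (EFin \o (fun x => `|a x| `^ q)).
Proof.
move=> q1 ma D0 sa.
have := @integrable_powR_increment q d T mu a (fun=> 0) D D q1 ma (measurable_cst _) D0 D0.
rewrite (_ : (fun x => a x - 0) = a); last by apply/funext => x; rewrite subr0.
move=> /(_ sa sa (subgaussian_tail0 _ _)).
rewrite (_ : (fun x => _) = (fun x => `|a x| `^ q))//.
by apply/funext => x; rewrite normr0 powR0 ?subr0// gt_eqF//; lra.
Qed.

(** Continuity of the q-th moment for the distance: the normalized increment is at most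
    1 plus its square. *)
Lemma mean_increment (q : R) : 1 <= q -> exists2 K : R, 1 <= K &
  forall d (T : measurableType d) (mu : probability T R) (a b : T -> R) (delta D : R),
  measurable_fun setT a -> measurable_fun setT b -> 0 < delta -> 0 < D ->
  subgaussian_tail C1 mu (fun x => a x - b x) delta ->
  subgaussian_tail C1 mu a D -> subgaussian_tail C1 mu b D ->
  `|\int[mu]_x (`|a x| `^ q) - \int[mu]_x (`|b x| `^ q)| <=
    K * (delta * D `^ (q - 1)).
Proof.
move=> q1; have [V V1 HV] := increment_moment q1.
exists (1 + V); first lra.
move=> d T mu a b delta D ma mb delta0 D0 sab sa sb.
have dD0 : 0 < delta * D `^ (q - 1) by rewrite mulr_gt0 ?powR_gt0.
have [Y [mY YV hY]] := HV d T mu a b delta D ma mb delta0 D0 sab sa sb.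
have ia := integrable_powR q1 ma D0 sa.
have ib := integrable_powR q1 mb D0 sb.
have iab := integrable_powR_increment q1 ma mb delta0 D0 sab sa sb.
rewrite -RintegralB//.
apply: (le_trans (le_normr_Rintegral _ _)) => //.
have Y0 x : 0 <= Y x by apply: le_trans (sqr_le_of_expR (hY x)); exact: sqr_ge0.
have iabs : mu.-integrable setT (EFin \o (fun x => `| `|a x| `^ q - `|b x| `^ q|)).
  exact: (integrable_norm iab).
rewrite -lee_fin /Rintegral fineK ?(integrable_fin_num _ iabs)//.
apply: (@le_trans _ _ (\int[mu]_x ((delta * D `^ (q - 1))%:E * (1%:E + (Y x)%:E)))%E).
  apply: ge0_le_integral => //.
  - exact: (measurable_int _ iabs).
  - by apply: measurable_funeM; apply: emeasurable_funD => //; exact/measurable_EFinP.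
  - move=> x _; rewrite -EFinD -EFinM lee_fin mulrC -ler_pdivrMr//.
    rewrite -[X in _ / X](gtr0_norm dD0) -normfV -normrM.
    set h := _ / _; have : `|h| ^+ 2 <= Y x.
      by rewrite real_normK ?num_real//; exact: sqr_le_of_expR (hY x).
    by have := sqr_ge0 (`|h| - 1); have := normr_ge0 h; nra.
rewrite ge0_integralZl_EFin//; last 3 first.
- by move=> x _; rewrite -EFinD lee_fin addr_ge0.
- by apply: emeasurable_funD => //; exact/measurable_EFinP.
- exact: ltW.
rewrite [(1 + V) * _]mulrC [leRHS]EFinM lee_wpmul2l ?lee_fin ?(ltW dD0)//.
rewrite ge0_integralD//; last 2 first.
- by move=> x _; rewrite lee_fin.
- exact/measurable_EFinP.
by rewrite (integral_cst mu measurableT) [X in (_ * X)%E]probability_setT mule1 EFinD leeD2l.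
Qed.

Lemma measureU3_le d (T : measurableType d) (P : probability T R)
    (A B C : set T) (e : R) :
  measurable A -> measurable B -> measurable C ->
  (P A <= e%:E)%E -> (P B <= e%:E)%E -> (P C <= e%:E)%E ->
  (P (A `|` B `|` C) <= (3 * e)%:E)%E.
Proof.
move=> mA mB mC hA hB hC.
have -> : (3 * e)%:E = (e%:E + e%:E + e%:E)%E by rewrite -!EFinD; congr EFin; lra.
apply: le_trans (measureU2 _ _ _) _ => //; first exact: measurableU.
by rewrite leeD//; apply: le_trans (measureU2 _ _ _) _ => //; rewrite leeD.
Qed.

(** The estimate for a single link.  Chernoff's inequality is applied to the truncated
    increment with both signs and to the squares of the large part, with
    l = sqrt(t / N).  The bound [S] on the (q-1)-st powers is quantified after the
    exceptional event, so that it may itself be a random bound. *)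
Lemma power_increment_tail (q : R) : 1 <= q -> exists2 K : R, 1 <= K &
  forall (dT : measure_display) (T : measurableType dT) (mu : probability T R)
    (dW : measure_display) (W : measurableType dW) (P : probability W R)
    (N : nat) (X_ : 'I_N -> {RV P >-> T}), (0 < N)%N -> iid_sample mu X_ ->
  forall (a b : T -> R) (delta D t : R),
  measurable_fun setT a -> measurable_fun setT b ->
  0 < delta -> 0 < D -> 0 < t ->
  subgaussian_tail C1 mu (fun x => a x - b x) delta ->
  subgaussian_tail C1 mu a D -> subgaussian_tail C1 mu b D ->
  exists bad : set W, [/\ measurable bad, (P bad <= (3 * expR (- (6 * t)))%:E)%E &
    forall w, ~ bad w -> forall S : R, 0 < S ->
    \sum_(i < N) (`|a (X_ i w)| `^ (q - 1)) ^+ 2 <= S ^+ 2 ->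
    \sum_(i < N) (`|b (X_ i w)| `^ (q - 1)) ^+ 2 <= S ^+ 2 ->
    `|\sum_(i < N) (`|a (X_ i w)| `^ q - `|b (X_ i w)| `^ q)
      - N%:R * (\int[mu]_x (`|a x| `^ q) - \int[mu]_x (`|b x| `^ q))| <=
    K * (delta * Num.sqrt t * (Num.sqrt N%:R * D `^ (q - 1) + S))].
Proof.
move=> q1; have [V V1 HV] := increment_moment q1.
exists (q * (4 * V + 25)); first by nra.
move=> dT T mu dW W P N X_ N0 [lawX indX] a b delta D t ma mb delta0 D0 t0 sab sa sb.
have [Y [mY YV hY]] := HV dT T mu a b delta D ma mb delta0 D0 sab sa sb.
have hY2 x := sqr_le_of_expR (hY x).
set dD := delta * D `^ (q - 1).
have dD0 : 0 < dD by rewrite mulr_gt0 ?powR_gt0.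
pose h x := (`|a x| `^ q - `|b x| `^ q) / dD.
pose z x := (a x - b x) / delta.
have mh : measurable_fun setT h.
  apply: measurable_funM => //.
  by apply: measurable_funB; exact: measurable_abs_powR.
have mz : measurable_fun setT z.
  by apply: measurable_funM => //; exact: measurable_funB.
pose n : R := Num.sqrt N%:R; pose s : R := Num.sqrt t.
have n0 : 0 < n by rewrite sqrtr_gt0 ltr0n.
have s0 : 0 < s by rewrite sqrtr_gt0.
have n2 : n ^+ 2 = N%:R by rewrite sqr_sqrtr// ler0n.
have s2 : s ^+ 2 = t by rewrite sqr_sqrtr// ltW.
pose l : R := s / n; pose m : R := \int[mu]_x h x.
pose f1 l x := if `|l * h x| <= 1 then l * h x else 0.
pose f2 x := if `|l * h x| <= 1 then 0 else z x ^+ 2 / 4.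
have mif k : measurable_fun setT (fun x => `|k * h x| <= 1).
  apply: measurable_fun_ler => //; apply: measurableT_comp => //.
  exact: measurable_funM.
have mf1 k : measurable_fun setT (f1 k).
  apply: measurable_fun_if => //.
  exact: measurable_funTS (measurable_funM _ _).
have mf2 : measurable_fun setT f2.
  apply: measurable_fun_if => //; apply: measurable_funTS.
  by apply: measurable_funM => //; exact: measurable_funX.
have H1 k := truncated_mgf k mh mY hY2 YV.
have H2 := large_part_mgf l mh mz mY hY YV.
pose bad (f : T -> R) c := [set w | (N%:R * c + 6 * t <= \sum_(i < N) f (X_ i w))%R].
have mbad f c : measurable_fun setT f -> measurable (bad f c).
  by move=> mf; exact: measurable_iid_ge.
pose c1 k := k * m + 2 * k ^+ 2 * V.
exists (bad (f1 l) (c1 l) `|` bad (f1 (- l)) (c1 (- l)) `|` bad f2 (l ^+ 2 * V)); split.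
- by do 2?apply: measurableU; exact: mbad.
- have ch (f : T -> R) c : measurable_fun setT f ->
      (\int[mu]_x (expR (f x))%:E <= (expR c)%:E)%E ->
      (P (bad f c) <= (expR (- (6 * t)))%:E)%E.
    by move=> mf; exact: (chernoff_iid lawX indX).
  apply: measureU3_le; do 1?exact: mbad.
  + exact: (ch _ _ (mf1 _) (H1 l)).
  + exact: (ch _ _ (mf1 _) (H1 (- l))).
  + exact: (ch _ _ mf2 H2).
move=> w /not_orP[/not_orP[b1 b2] b3] S S0 Sa Sb.
have DD0 : 0 < D `^ (q - 1) by rewrite powR_gt0.
have bE f c : ~ bad f c w ->
    \sum_(i < N) f (X_ i w) <= n ^+ 2 * c + 6 * s ^+ 2.
  by rewrite n2 s2 => /negP; rewrite -ltNge => /ltW.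
have powE v : `|v / D| `^ (q - 1) = `|v| `^ (q - 1) / D `^ (q - 1).
  by rewrite normrM normfV (gtr0_norm D0) powRM ?invr_ge0 ?(ltW D0)// powRV// ltW.
have sumE (f : T -> R) : \sum_(i < N) (`|f (X_ i w)| `^ (q - 1)) ^+ 2 <= S ^+ 2 ->
    \sum_(i < N) (`|f (X_ i w) / D| `^ (q - 1)) ^+ 2 <= (S / D `^ (q - 1)) ^+ 2.
  move=> fS; under eq_bigr do rewrite powE expr_div_n.
  by rewrite expr_div_n -mulr_suml ler_pM2r// invr_gt0 exprn_gt0.
have := @sum_le_of_truncations R 'I_N (h \o X_^~ w) (z \o X_^~ w)
  (fun i => `|a (X_ i w) / D| `^ (q - 1)) (fun i => `|b (X_ i w) / D| `^ (q - 1))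
  m s n V (S / D `^ (q - 1)) q q1 s0 n0 (divr_gt0 S0 DD0) V1
  (fun i => powR_ge0 _ _) (fun i => powR_ge0 _ _)
  (fun i => normalized_increment _ _ q1 delta0 D0) (sumE _ Sa) (sumE _ Sb)
  (bE _ _ b1) (bE _ _ b2) (bE _ _ b3).
have ia := integrable_powR q1 ma D0 sa.
have ib := integrable_powR q1 mb D0 sb.
have iab := integrable_powR_increment q1 ma mb delta0 D0 sab sa sb.
have mE : m = (\int[mu]_x (`|a x| `^ q) - \int[mu]_x (`|b x| `^ q)) / dD.
  rewrite /m -RintegralB// -RintegralZr//.
rewrite -(ler_pM2l dD0) -{1}(gtr0_norm dD0) -normrM n2 mulrBr.
have -> : dD * (N%:R * m) =
    N%:R * (\int[mu]_x (`|a x| `^ q) - \int[mu]_x (`|b x| `^ q)).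
  by rewrite mE mulrCA (mulrC dD) divfK ?gt_eqF.
rewrite mulr_sumr.
rewrite (eq_bigr (fun i => `|a (X_ i w)| `^ q - `|b (X_ i w)| `^ q)); last first.
  by move=> i _; rewrite /= /h mulrC divfK ?gt_eqF.
move=> /le_trans; apply.
rewrite /dD -/n -/s le_eqVlt; apply/orP; left; apply/eqP.
by field; rewrite gt_eqF.
Qed.

(** Once N <= t^(p/2), the l_p norm of g on the sample behaves as in the Gaussian
    case.  The truncation level t / N for |g|^p balances the two parts of the
    minimum in [expR_min]. *)
Lemma power_sum_tail (p : R) : 2 <= p -> exists2 K : R, 1 <= K &
  forall (dT : measure_display) (T : measurableType dT) (mu : probability T R)
    (dW : measure_display) (W : measurableType dW) (P : probability W R)
    (N : nat) (X_ : 'I_N -> {RV P >-> T}), (0 < N)%N -> iid_sample mu X_ ->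
  forall (g : T -> R) (delta t : R),
  measurable_fun setT g -> 0 < delta -> 0 < t -> N%:R <= t `^ (p / 2) ->
  subgaussian_tail C1 mu g delta ->
  exists bad : set W, [/\ measurable bad, (P bad <= (3 * expR (- (6 * t)))%:E)%E &
    forall w, ~ bad w ->
    \sum_(i < N) `|g (X_ i w)| `^ p <= (K * (delta * Num.sqrt t)) `^ p].
Proof.
move=> p2; have [B B1 HB] := subgaussian_expR_sqr hC1.
have [c c1 Hc] : exists2 c : R, 1 <= c & forall x : R,
    `|x| `^ p * expR (x ^+ 2 / 4) <= c * expR (x ^+ 2 / 2).
  by apply: powR_expR_sqr; lra.
have V1 : 1 <= c * B by rewrite -[leLHS]mulr1 ler_pM.
(* 4 c B comes from the exponential moment and 6 from the probability exp(-6t). *)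
exists (4 * (4 * (c * B) + 6)); first by lra.
move=> dT T mu dW W P N X_ N0 [lawX indX] g delta t mg delta0 t0 Nt sg.
have n0 : 0 < N%:R :> R by rewrite ltr0n.
pose z x := g x / delta.
have mz : measurable_fun setT z by exact: measurable_funM.
pose Y x := c * expR (z x ^+ 2 / 2).
have mY : measurable_fun setT Y.
  apply: measurable_funM => //; apply: measurableT_comp => //.
  by apply: measurable_funM => //; exact: measurable_funX.
have YV : (\int[mu]_x (Y x)%:E <= (c * B)%:E)%E.
  under eq_integral do rewrite EFinM.
  rewrite ge0_integralZl_EFin//; last 2 first.
  - apply/measurable_EFinP; apply: measurableT_comp => //.
    by apply: measurable_funM => //; exact: measurable_funX.
  - lra.
  by rewrite EFinM lee_wpmul2l ?lee_fin//; [lra|exact: HB].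
have tn0 : 0 <= t / N%:R by rewrite divr_ge0// ltW.
have H := minimum_mgf mz mY tn0 (fun x => Hc (z x)) YV.
pose f x := Num.min (t / N%:R * `|z x| `^ p) (z x ^+ 2 / 4).
have mf : measurable_fun setT f.
  apply: measurable_minr; apply: measurable_funM => //.
  + exact: measurable_abs_powR.
  + exact: measurable_funX.
pose bad := [set w | (N%:R * (4 * (t / N%:R) * (c * B)) + 6 * t <= \sum_(i < N) f (X_ i w))%R].
exists bad; split; first exact: measurable_iid_ge.
  apply: (@le_trans _ _ (expR (- (6 * t)))%:E).
    exact: (chernoff_iid lawX indX (6 * t) mf H).
  by rewrite lee_fin ler_peMl ?expR_ge0//; lra.
move=> w /negP; rewrite -ltNge => /ltW hw.
have := @sum_powR_of_min R 'I_N (z \o X_^~ w) p N%:R t (4 * (c * B) + 6) p2 n0 t0 _ Nt.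
have -> : (4 * (c * B) + 6) * t = N%:R * (4 * (t / N%:R) * (c * B)) + 6 * t.
  by field; rewrite gt_eqF.
move=> /(_ _ hw) h.
have d0 : 0 < delta `^ p by rewrite powR_gt0.
rewrite (_ : \sum_(i < N) _ = delta `^ p * \sum_(i < N) `|z (X_ i w)| `^ p); last first.
  rewrite mulr_sumr; apply: eq_bigr => i _.
  rewrite -powRM ?(ltW delta0)// /z normrM normfV (gtr0_norm delta0).
  by rewrite mulrC divfK// gt_eqF.
rewrite mulrCA powRM ?(ltW delta0)//; last by rewrite mulr_ge0 ?sqrtr_ge0//; lra.
rewrite ler_pM2l//; apply: h; lra.
Qed.

End links.

(** * Generic chaining *)

Section union_bounds.
Context {R : realType} {d : measure_display} {W : measurableType d}
  (P : probability W R).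

Lemma probability_bigsetU_le (B : nat -> set W) (e : nat -> R) n :
  (forall i, (i < n)%N -> measurable (B i) /\ (P (B i) <= (e i)%:E)%E) ->
  measurable (\big[setU/set0]_(i < n) B i) /\
  (P (\big[setU/set0]_(i < n) B i) <= (\sum_(i < n) e i)%:E)%E.
Proof.
elim: n => [_|n IH H]; first by rewrite !big_ord0 measure0.
have [|mU PU] := IH; first by move=> i /ltnW/H.
have [mB PB] := H n (ltnSn n).
rewrite !big_ord_recr/=; split; first exact: measurableU.
by rewrite EFinD; apply: le_trans (measureU2 _ mU mB) _; rewrite leeD.
Qed.

(** The index set lives in a type without decidable equality, so it is first
    transported to an initial segment of the natural numbers. *)
Lemma probability_bigcup_le (U : Type) (A : set U) k (B : U -> set W) (e : R) :
  (A #<= `I_k)%card -> 0 <= e ->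
  (forall a, A a -> measurable (B a) /\ (P (B a) <= e%:E)%E) ->
  measurable (\bigcup_(a in A) B a) /\
  (P (\bigcup_(a in A) B a) <= (k%:R * e)%:E)%E.
Proof.
move=> /pcard_leP[f] e0 HB.
pose C i := \bigcup_(a in [set a | A a /\ f a = i]) B a.
have HC i : (i < k)%N -> measurable (C i) /\ (P (C i) <= e%:E)%E.
  move=> ik; have [[a [Aa fa]]|na] := pselect (exists a, A a /\ f a = i).
    suff -> : C i = B a by exact: HB.
    apply/seteqP; split => [w [b [Ab fb]] Bw|w Bw]; last by exists a.
    have <- // : b = a.
    apply: (@inj _ _ _ f); [exact: mem_set|exact: mem_set|exact: (etrans fb (esym fa))].
  suff -> : C i = set0 by rewrite measure0 lee_fin.
  by apply/seteqP; split => w // [a Aa]; exfalso; apply: na; exists a.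
have -> : \bigcup_(a in A) B a = \big[setU/set0]_(i < k) C i.
  apply/seteqP; split => [w [a Aa Bw]|w].
    rewrite -bigcup_mkord; exists (f a); first exact: funS.
    by exists a.
  by rewrite -bigcup_mkord => -[i _ [a [Aa _]] Bw]; exists a.
have [mC PC] := probability_bigsetU_le HC.
split => //; apply: (le_trans PC).
by rewrite sumr_const card_ord mulr_natl.
Qed.

End union_bounds.

Section chaining_sets.
Context {R : realType} {U : Type}.
Variables (d : U -> U -> R) (F : set U) (D Gamma : R).
Hypothesis Gamma0 : 0 < Gamma.
Hypothesis d_ge0 : forall f g, F f -> F g -> 0 <= d f g.
Variable A_ : nat -> set U.
Hypothesis subA : forall n, A_ n `<=` F.
Hypothesis gammaA : forall f, F f ->
  (\sum_(0 <= n <oo) ((2 `^ (n%:R / 2))%:E * dist_set d f (A_ n)) <= Gamma%:E)%E.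

(** The weight 2^(n/2) of the n-th level. *)
Definition level n : R := Num.sqrt (2 ^+ n).

Lemma level_powR n : level n = 2 `^ (n%:R / 2).
Proof. by rewrite powRrM powR_mulrn// powR12_sqrt// exprn_ge0. Qed.

Lemma level_gt0 n : 0 < level n.
Proof. by rewrite sqrtr_gt0 exprn_gt0. Qed.

Lemma level_sqr n : level n ^+ 2 = 2 ^+ n.
Proof. by rewrite sqr_sqrtr// exprn_ge0. Qed.

Lemma level_le n : level n <= 2 ^+ n.
Proof.
rewrite -level_sqr expr2 ler_peMl ?(ltW (level_gt0 _))//.
rewrite -(@ler_pXn2r _ 2) ?nnegrE ?(ltW (level_gt0 _))// level_sqr expr1n.
by rewrite exprn_ege1// ler1n.
Qed.

Lemma levelS_le n : level n.+1 <= 2 * level n.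
Proof.
rewrite -(@ler_pXn2r _ 2) ?nnegrE ?mulr_ge0 ?(ltW (level_gt0 _))//.
by rewrite exprMn !level_sqr exprS ler_pM2r ?exprn_gt0//; lra.
Qed.

Let eps n : R := Gamma * (4^-1) ^+ n.

Lemma sum_level_eps m : \sum_(0 <= n < m) level n * eps n <= 2 * Gamma.
Proof.
apply: (@le_trans _ _ (\sum_(0 <= n < m) Gamma * (2^-1) ^+ n)).
  apply: ler_sum => n _; rewrite /eps mulrCA ler_pM2l//.
  apply: (@le_trans _ _ (2 ^+ n * (4^-1) ^+ n)).
    by rewrite ler_wpM2r ?level_le// exprn_ge0.
  by rewrite -exprMn (_ : 2 * 4^-1 = 2^-1)//; lra.
rewrite -mulr_sumr mulrC ler_pM2r//.
apply: le_trans (sum_geometric_le _ _) _; first lra.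
rewrite (_ : (1 - 2^-1) = 2^-1 :> R) ?invrK//; lra.
Qed.

(** The infimum defining the distance to A_n need not be attained, so a geometric error
    is added to it; its weighted sum is at most 2 Gamma.  In particular A_n is
    nonempty, since an infinite distance would make the weighted sum infinite. *)
Lemma approximating_points : exists (proj : nat -> U -> U) (r : nat -> U -> R),
  forall f, F f -> (forall n, [/\ A_ n (proj n f), d f (proj n f) <= r n f & 0 <= r n f])
    /\ forall m, \sum_(0 <= n < m) level n * r n f <= 3 * Gamma.
Proof.
pose dd n f := fine (dist_set d f (A_ n)).
pose r n f := dd n f + eps n.
have e0 n : 0 < eps n by rewrite mulr_gt0// exprn_gt0.
have dd0 n f : F f -> (0 <= dist_set d f (A_ n))%E.
  move=> Ff; apply: le_ereal_inf_tmp => _ [g Ag <-].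
  by rewrite lee_fin d_ge0//; exact: subA Ag.
have term0 n f : F f -> (0 <= (2 `^ (n%:R / 2))%:E * dist_set d f (A_ n))%E.
  by move=> Ff; rewrite mule_ge0 ?dd0// lee_fin powR_ge0.
have part f m : F f -> (\sum_(0 <= n < m)
    ((2 `^ (n%:R / 2))%:E * dist_set d f (A_ n)) <= Gamma%:E)%E.
  move=> Ff; apply: le_trans (gammaA Ff); apply: nneseries_lim_ge => n _ _.
  exact: term0.
have ddfin n f : F f -> dist_set d f (A_ n) = (dd n f)%:E.
  move=> Ff; rewrite fineK// ge0_fin_numE ?dd0//.
  have := part f n.+1 Ff; rewrite big_nat_recr//=.
  rewrite ltNge leye_eq; apply: contraTN => /eqP ->.
  rewrite gt0_muley ?lte_fin ?powR_gt0// -ltNge addey ?ltry//.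
  by rewrite gt_eqF// (lt_le_trans ltNy0)// sume_ge0// => i _; exact: term0.
have near n f : exists g, F f -> A_ n g /\ d f g <= r n f.
  have [Ff|nF] := pselect (F f); last by exists f.
  have : (dist_set d f (A_ n) < (r n f)%:E)%E.
    by rewrite ddfin// lte_fin /r ltrDl.
  by move=> /ereal_inf_lt[_ [g Ag <-]]; rewrite lte_fin => /ltW h; exists g.
have [proj Hp] := choice (fun nf : nat * U => near nf.1 nf.2).
exists (fun n f => proj (n, f)), r => f Ff; split.
  move=> n; have [h1 h2] := Hp (n, f) Ff; split => //.
  by rewrite addr_ge0 ?(ltW (e0 _))// fine_ge0// dd0.
move=> m; under eq_bigr do rewrite mulrDr.
rewrite big_split/= (_ : 3 * Gamma = Gamma + 2 * Gamma); last by lra.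
rewrite lerD ?sum_level_eps// -lee_fin -sumEFin.
apply: le_trans (part f m Ff); apply: lee_sum => n _.
by rewrite ddfin// level_powR.
Qed.

Lemma sum_shift_le (g : nat -> R) (B : R) c M : (forall n, 0 <= g n) ->
  (forall m, \sum_(0 <= n < m) g n <= B) ->
  \sum_(0 <= k < M) g (c + k)%N <= B.
Proof.
move=> g0 gB; apply: le_trans (gB (c + M)%N).
rewrite [leRHS](@big_cat_nat _ _ _ c)//= ?leq_addr//.
have -> : \sum_(c <= i < c + M) g i = \sum_(0 <= k < M) g (c + k)%N.
  by rewrite -{1}(add0n c) big_addn addKn; apply: eq_bigr => i _; rewrite addnC.
by rewrite lerDr sumr_ge0.
Qed.

Hypothesis cardA : forall n, (A_ n #<= `I_(2 ^ (2 ^ n))%N)%card.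
Hypothesis d_refl : forall f, F f -> d f f = 0.
Hypothesis d_sym : forall f g, F f -> F g -> d f g = d g f.
Hypothesis d_tri : forall f g h, F f -> F g -> F h -> d f h <= d f g + d g h.
Hypothesis d_le : forall f g, F f -> F g -> d f g <= D.

(** Counting the pairs of a link costs a factor exp(2t), out of the exp(-6t) available. *)
Lemma card_le_expR n : (2 ^ (2 ^ n))%:R <= expR (2 ^+ n) :> R.
Proof.
have e2 : 2 <= expR 1 :> R by have := expR_ge1Dx (1 : R); lra.
rewrite -[X in expR X]mulr1 -natrX expRM_natl natrX.
by rewrite lerXn2r ?nnegrE ?expR_ge0.
Qed.

(** The levels 2^(n0+k) exceed 2^n0 + k, so that the series is geometric with ratio
    exp(-4); the factor exp(-3) gained from 4 2^n0 >= u + 3 absorbs the constants. *)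
Lemma sum_expR_levels (u : R) n0 M : 1 <= u -> u <= 2 ^+ n0 ->
  \sum_(0 <= k < M) 3 * expR (- (4 * 2 ^+ (n0 + k))) <= expR (- u) / 2.
Proof.
move=> u1 un0.
have e2 : 2 <= expR 1 :> R by have := expR_ge1Dx (1 : R); lra.
have h2 : expR (- 1) <= 2^-1 :> R by rewrite expRN lef_pV2 ?posrE ?expR_gt0.
have h0 : 0 <= expR (- 1) :> R by exact: expR_ge0.
apply: (@le_trans _ _ (\sum_(0 <= k < M) (3 * expR (- u - 3)) * expR (- 4) ^+ k)).
  apply: ler_sum => k _; rewrite -mulrA ler_pM2l// -expRM_natl -expRD ler_expR.
  have : 2 ^+ n0 + k%:R <= 2 ^+ (n0 + k) :> R.
    rewrite exprD; have k2 : 1 + k%:R <= 2 ^+ k :> R.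
      by rewrite nat1r -natrX ler_nat ltn_expl.
    have n1 : 1 <= 2 ^+ n0 :> R by rewrite exprn_ege1// ler1n.
    have : (0 : R) <= k%:R by exact: ler0n.
    by nra.
  lra.
rewrite -mulr_sumr.
have E4 : expR (- 4) = expR (- 1) ^+ 4 :> R.
  by rewrite -expRM_natl; congr expR; lra.
have E3 : expR (- 3) = expR (- 1) ^+ 3 :> R.
  by rewrite -expRM_natl; congr expR; lra.
have b4 : expR (- 4) <= 2^-1 ^+ 4 :> R by rewrite E4 lerXn2r ?nnegrE.
have b3 : expR (- 3) <= 2^-1 ^+ 3 :> R by rewrite E3 lerXn2r ?nnegrE.
have b40 : 0 <= expR (- 4) :> R by exact: expR_ge0.
have c4 : 2^-1 ^+ 4 = 1 / 16 :> R by field.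
have c3 : 2^-1 ^+ 3 = 1 / 8 :> R by field.
have g := @sum_geometric_le R (expR (- 4)) M.
have {}g : \sum_(0 <= k < M) expR (- 4) ^+ k <= 16 / 15 :> R.
  apply: le_trans (g _) _; first by rewrite b40/=; lra.
  by rewrite -[16 / 15]invrK lef_pV2 ?posrE//; lra.
rewrite expRD -mulrA [leLHS]mulrCA mulrAC -mulrA ler_wpM2l ?expR_ge0//.
have s0 : 0 <= \sum_(0 <= k < M) expR (- 4) ^+ k :> R.
  by apply: sumr_ge0 => k _; exact: exprn_ge0.
have b30 : 0 <= expR (- 3) :> R by exact: expR_ge0.
nra.
Qed.

(** The chain of f runs from z0 through the points of A_n nearest to f, for n0 <= n < m,
    and ends at f itself; m is so large that H has at most 2^(2^m) elements, hence
    every link belongs to one of at most 2^(2^(n+1)) pairs.  The link property [L] is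
    arbitrary, as the same chaining is used for the increments of |f|^q and for the
    l_p norms.  A positive term is added to the distances, so that links of length 0 need
    no separate treatment.  The set [H'] gathers all points of all chains. *)
Lemma generic_chaining (dW : measure_display) (W : measurableType dW)
    (P : probability W R) (z0 : U) (H : set U) (J n0 : nat) (u : R)
    (L : R -> R -> U -> U -> W -> Prop) :
  F z0 -> H `<=` F -> (H #<= `I_J)%card -> 1 <= u -> u <= 2 ^+ n0 ->
  (forall t delta a b, 2 ^+ n0 <= t -> F a -> F b -> 0 < delta -> d a b <= delta ->
    exists bad : set W, [/\ measurable bad, (P bad <= (3 * expR (- (6 * t)))%:E)%E &
      forall w, ~ bad w -> L t delta a b w]) ->
  exists (H' : set U) (bad : set W), [/\ finite_set H', H' `<=` F,
    measurable bad, (P bad <= (expR (- u) / 2)%:E)%E &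
    forall w f, ~ bad w -> H f ->
    exists M (s : nat -> U) (delta : nat -> R), [/\ s 0%N = z0, s M = f,
      (forall k, (k <= M)%N -> H' (s k)),
      (forall k, (k < M)%N -> 0 < delta k /\
        L (2 ^+ (n0 + k)) (delta k) (s k.+1) (s k) w) &
      \sum_(0 <= k < M) level (n0 + k) * delta k <= level n0 * D + 11 * Gamma]].
Proof.
move=> Fz0 HF cH u1 un0 HL.
have [proj [r Hr]] := approximating_points.
(* J <= 2^(2^J), and hence the last level can hold all of H. *)
pose m := maxn n0 J; pose M := (m - n0).+1.
have n0m : (n0 <= m)%N by exact: leq_maxl.
pose Sg k := if k is k'.+1 then
  (if (n0 + k' < m)%N then A_ (n0 + k') else H) else [set z0].
pose dl k a b := d a b + eps (n0 + k).
have e0 n : 0 < eps n by rewrite mulr_gt0// exprn_gt0.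
have SgF k : Sg k `<=` F.
  case: k => [|k] /=; first by move=> _ ->.
  by case: ifP => _ //; exact: subA.
have leI n k : (n <= k)%N -> (`I_(2 ^ 2 ^ n) #<= `I_(2 ^ 2 ^ k))%card.
  by move=> nk; rewrite card_le_II !leq_pexp2l.
have cS k : (Sg k.+1 #<= `I_(2 ^ 2 ^ (n0 + k)))%card.
  rewrite /=; case: ifPn => [_|]; first exact: cardA.
  rewrite -leqNgt => mk; apply: card_le_trans (leI _ _ mk).
  apply: card_le_trans cH _; rewrite card_le_II.
  apply: (@leq_trans m); first exact: leq_maxr.
  by apply: (leq_trans (ltnW (ltn_expl m (leqnn 2)))); exact/ltnW/ltn_expl.
have cS' k : (Sg k #<= `I_(2 ^ 2 ^ (n0 + k)))%card.
  case: k => [|k]; last first.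
    by apply: card_le_trans (cS k) _; apply: leI; rewrite addnS.
  apply: (@card_le_trans _ _ _ `I_1); last by rewrite card_le_II expn_gt0.
  by rewrite (card_le_eql card_set1).
have link (x : nat * U * U) : exists B : set W, F x.1.2 -> F x.2 ->
    [/\ measurable B, (P B <= (3 * expR (- (6 * 2 ^+ (n0 + x.1.1))))%:E)%E &
     forall w, ~ B w -> L (2 ^+ (n0 + x.1.1)) (dl x.1.1 x.1.2 x.2) x.1.2 x.2 w].
  have [[Fa Fb]|nF] := pselect (F x.1.2 /\ F x.2); last first.
    by exists set0 => Fa Fb; exfalso; exact: nF.
  have [|||B HB] := HL (2 ^+ (n0 + x.1.1)) (dl x.1.1 x.1.2 x.2) _ _ _ Fa Fb.
  - by rewrite ler_weXn2l ?leq_addr// ler1n.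
  - by rewrite /dl ltr_wpDl ?d_ge0.
  - by rewrite /dl lerDl ltW.
  by exists B.
have [B HB] := choice link.
pose BB k := \bigcup_(a in Sg k.+1) \bigcup_(b in Sg k) B (k, a, b).
have HBB k : (k < M)%N ->
    measurable (BB k) /\ (P (BB k) <= (3 * expR (- (4 * 2 ^+ (n0 + k))))%:E)%E.
  move=> _; pose K := (2 ^ 2 ^ (n0 + k))%N.
  pose e := 3 * expR (- (6 * 2 ^+ (n0 + k))) : R.
  have ee0 : 0 <= e by rewrite mulr_ge0 ?expR_ge0.
  have inner a : Sg k.+1 a -> measurable (\bigcup_(b in Sg k) B (k, a, b)) /\
      (P (\bigcup_(b in Sg k) B (k, a, b)) <= (K%:R * e)%:E)%E.
    move=> Sa; apply: (probability_bigcup_le (cS' k) ee0) => b Sb.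
    by have [] := HB (k, a, b) (SgF _ _ Sa) (SgF _ _ Sb).
  have Ke0 : 0 <= K%:R * e by rewrite mulr_ge0.
  have [mB PB] := probability_bigcup_le (cS k) Ke0 inner.
  split => //; apply: (le_trans PB); rewrite lee_fin -/K /e.
  have KE : K%:R <= expR (2 ^+ (n0 + k)) :> R by exact: card_le_expR.
  apply: (@le_trans _ _ (expR (2 ^+ (n0 + k)) * (expR (2 ^+ (n0 + k)) *
      (3 * expR (- (6 * 2 ^+ (n0 + k))))))).
    by rewrite ler_pM ?ler_wpM2r ?mulr_ge0 ?expR_ge0.
  rewrite mulrCA [expR _ * (3 * _)]mulrCA mulrCA ler_pM2l// -!expRD ler_expR; lra.
have [mBad PBad] := probability_bigsetU_le HBB.
exists (\bigcup_(k in `I_M.+1) Sg k), (\big[setU/set0]_(i < M) BB i); split => //.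
- apply: bigcup_finite; first exact: finite_II.
  by move=> k _; apply: card_le_finite (cS' k) (finite_II _).
- by move=> f [k _] /SgF.
- apply: (le_trans PBad); rewrite lee_fin -(big_mkord xpredT
    (fun i => 3 * expR (- (4 * 2 ^+ (n0 + i))))).
  exact: sum_expR_levels.
move=> w f nBad Hf; have Ff := HF _ Hf; have [Hp rS] := Hr f Ff.
pose s k := if k is k'.+1 then (if (n0 + k' < m)%N then proj (n0 + k')%N f else f)
  else z0.
have Ss k : Sg k (s k).
  by case: k => //= k; case: ifP => // _; case: (Hp (n0 + k)%N).
have ds k : d f (s k.+1) <= r (n0 + k)%N f.
  have [_ h1 h2] := Hp (n0 + k)%N; rewrite /=; case: ifP => // _.
  by rewrite d_refl.
exists M, s, (fun k => dl k (s k.+1) (s k)); split => //.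
- by rewrite /s /M subnKC// ltnn.
- by move=> k kM; exists k.
- move=> k kM; split; first by rewrite /dl ltr_wpDl// d_ge0//; exact: SgF (Ss _).
  have [_ _] := HB (k, s k.+1, s k) (SgF _ _ (Ss _)) (SgF _ _ (Ss _)).
  apply => Bw; apply: nBad; rewrite -bigcup_mkord; exists k => //.
  by exists (s k.+1) => //; exists (s k).
pose g n := level n * r n f.
have g0 n : 0 <= g n.
  by rewrite mulr_ge0 ?(ltW (level_gt0 _))//; case: (Hp n).
have gi n : 0 <= level n * eps n by rewrite mulr_ge0 ?(ltW (level_gt0 _)) ?(ltW (e0 _)).
under eq_bigr do rewrite /dl mulrDr.
rewrite big_split/= big_nat_recl//= addn0.
have -> : level n0 * D + 11 * Gamma =
  (level n0 * D + (3 * Gamma + 2 * (3 * Gamma))) + 2 * Gamma by lra.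
apply: lerD; last by apply: (@sum_shift_le (fun n => level n * eps n)) => //; exact: sum_level_eps.
have Fs1 := SgF _ _ (Ss 1%N); rewrite /= addn0 in Fs1.
apply: lerD; first by rewrite ler_pM2l ?level_gt0// d_le.
apply: (@le_trans _ _ (\sum_(0 <= k < m - n0) (g (n0.+1 + k)%N + 2 * g (n0 + k)%N))).
  apply: ler_sum => k _.
  have F1 := SgF _ _ (Ss k.+1); have F2 := SgF _ _ (Ss k.+2).
  have h1 := d_tri F2 Ff F1; have h2 := ds k; have h3 := ds k.+1.
  rewrite (d_sym Ff F2) in h3.
  apply: (@le_trans _ _ (level (n0 + k.+1) * (r (n0 + k.+1)%N f + r (n0 + k)%N f))).
    by rewrite ler_pM2l ?level_gt0//; apply: (le_trans h1); exact: lerD.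
  rewrite mulrDr addSnnS lerD// /g mulrA ler_wpM2r//; first by case: (Hp (n0 + k)%N).
  by rewrite addnS; exact: levelS_le.
rewrite big_split/= -mulr_sumr lerD ?ler_pM2l//.
- exact: (@sum_shift_le g).
- exact: (@sum_shift_le g).
Qed.

End chaining_sets.

(** * Power sums along a chain *)

(** A class together with a sequence of sets whose weighted distances sum to at most
    [Gamma]; [Gamma] plays the role of the functional gamma2, whose infimum need not be
    attained. *)
Record chaining_setting {R : realType} (C1 : R) {dT : measure_display}
    {T : measurableType dT} (mu : probability T R) (F : set (T -> R))
    (d : (T -> R) -> (T -> R) -> R) (D Gamma : R) (A_ : nat -> set (T -> R)) :
    Prop := ChainingSetting {
  setting_meas : forall f, F f -> measurable_fun setT f;
  setting_zero : F (fun=> 0);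
  setting_subgaussian : forall f g delta, F f -> F g -> 0 < delta ->
    d f g <= delta -> subgaussian_tail C1 mu (fun x => f x - g x) delta;
  setting_ge0 : forall f g, F f -> F g -> 0 <= d f g;
  setting_refl : forall f, F f -> d f f = 0;
  setting_sym : forall f g, F f -> F g -> d f g = d g f;
  setting_tri : forall f g h, F f -> F g -> F h -> d f h <= d f g + d g h;
  setting_diam : forall f g, F f -> F g -> d f g <= D;
  setting_D : 0 < D;
  setting_Gamma : 0 < Gamma;
  setting_sub : forall n, A_ n `<=` F;
  setting_card : forall n, (A_ n #<= `I_(2 ^ (2 ^ n))%N)%card;
  setting_sum : forall f, F f ->
    (\sum_(0 <= n <oo) ((2 `^ (n%:R / 2))%:E * dist_set d f (A_ n)) <= Gamma%:E)%E }.

Section deterministic_bounds.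
Context {R : realType}.

Lemma pow2_between (x : R) : 1 <= x -> exists n, x <= 2 ^+ n <= 2 * x.
Proof.
move=> x1; have x0 : 0 <= x by lra.
pose P n := x <= 2 ^+ n.
have exP : exists n, P n.
  exists (Num.truncn x).+1; rewrite /P.
  apply: (@le_trans _ _ (Num.truncn x).+1%:R).
    by apply/ltW; have /andP[] := truncn_itv x0.
  by rewrite -natrX ler_nat ltnW// ltn_expl.
case: (ex_minnP exP) => n Pn minP; exists n; rewrite -/(P n) Pn/=.
case: n Pn minP => [|n] Pn minP; first by rewrite expr0; lra.
have : ~~ P n by apply/negP => /minP; rewrite ltnn.
by rewrite /P -ltNge exprS => h; rewrite ler_pM2l// ltW.
Qed.

Lemma sum_powR_chain (N M : nat) (p K : R) (x : nat -> 'I_N -> R)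
    (w : nat -> R) : 1 <= p -> 0 < K -> (forall k, (k < M)%N -> 0 < w k) ->
  (forall i, x 0%N i = 0) ->
  (forall k, (k < M)%N ->
    \sum_(i < N) `|x k.+1 i - x k i| `^ p <= (K * w k) `^ p) ->
  \sum_(i < N) `|x M i| `^ p <= (K * \sum_(0 <= k < M) w k) `^ p.
Proof.
move=> p1 K0 w0 x0; elim: M w0 => [_ _|M IH w0 H].
  rewrite big_nil mulr0 powR0 ?gt_eqF//; last lra.
  by rewrite big1// => i _; rewrite x0 normr0 powR0// gt_eqF//; lra.
have {}IH := IH (fun k kM => w0 k (ltnW kM)) (fun k kM => H k (ltnW kM)).
rewrite big_nat_recr//= mulrDr.
have s0 : 0 <= K * \sum_(0 <= k < M) w k.
  rewrite mulr_ge0 ?(ltW K0)// big_nat_cond; apply: sumr_ge0 => k.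
  by rewrite andbT => /andP[_ /ltnW/w0/ltW].
have wM : 0 < K * w M by rewrite mulr_gt0 ?w0.
apply: le_trans (minkowski_sum p1 (fun i => normr_ge0 (x M i))
  (fun i => normr_ge0 (x M.+1 i - x M i)) s0 wM IH (H M (ltnSn M))).
apply: ler_sum => i _; rewrite ge0_ler_powR ?nnegrE ?addr_ge0//; first lra.
by rewrite -{1}(subrK (x M i) (x M.+1 i)) addrC ler_normD.
Qed.

Lemma sum_abs_chain (M : nat) (y : nat -> R) (w : nat -> R) (K : R) :
  y 0%N = 0 -> (forall k, (k < M)%N -> `|y k.+1 - y k| <= K * w k) ->
  `|y M| <= K * \sum_(0 <= k < M) w k.
Proof.
move=> y0; elim: M => [_|M IH H]; first by rewrite y0 big_nil mulr0 normr0.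
rewrite big_nat_recr//= mulrDr -(subrK (y M) (y M.+1)) addrC.
by apply: (le_trans (ler_normD _ _)); rewrite lerD ?H// IH// => k /ltnW/H.
Qed.

(** For 0 <= r <= 1, interpolates between the constant 1 and a. *)
Lemma powR_le1D (a r : R) : 0 <= a -> 0 <= r <= 1 -> a `^ r <= 1 + a.
Proof.
move=> a0 /andP[r0 r1]; have [a1|/ltW a1] := leP a 1.
  apply: (@le_trans _ _ 1); last by rewrite lerDl.
  by have := ge0_ler_powR r0 a0 ler01 a1; rewrite powR1.
by apply: le_trans (ler1_powR a1 r1) _; rewrite lerDr.
Qed.

Lemma powR_sqrC (a r : R) : 0 <= a -> (a `^ r) ^+ 2 = (a ^+ 2) `^ r.
Proof.
by move=> a0; rewrite -(powR_mulrn 2 (powR_ge0 a r)) -(powR_mulrn 2 a0) powRAC.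
Qed.

Lemma sqrt_ge1 (N : nat) : (0 < N)%N -> 1 <= Num.sqrt (N%:R : R).
Proof. by move=> N0; rewrite -[leLHS]sqrtr1 ler_wsqrtr// ler1n. Qed.

(** The Euclidean norm of the (q-1)-st powers.  For q >= 2 the exponent p is 2q-2 and this
    is the l_p bound itself.  For q <= 2 only the l_2 bound is available, and
    v^(q-1) <= c^(q-1) (1 + v / c), applied to the squares v of the entries with c a
    bound on their mean, produces the factor N^(1-q/2). *)
Lemma sum_sqr_powR_le (q K : R) : 1 <= q -> 1 <= K -> exists2 C : R, 1 <= C &
  forall (N : nat) (x : 'I_N -> R) (D Q : R), (0 < N)%N -> 0 < D -> 0 < Q ->
  let p := Num.max 2 (2 * q - 2) in
  \sum_(i < N) `|x i| `^ p <= (K * (D * N%:R `^ p^-1 + Q)) `^ p ->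
  \sum_(i < N) (`|x i| `^ (q - 1)) ^+ 2 <=
    (C * (Num.sqrt N%:R * D `^ (q - 1) +
          N%:R `^ (1 - Num.min 1 (q / 2)) * Q `^ (q - 1))) ^+ 2.
Proof.
move=> q1 K1; have q10 : 0 <= q - 1 by lra.
have K2 : 1 <= (2 * K) `^ (q - 1).
  have K21 : 1 <= 2 * K by lra.
  by have := ge0_ler_powR q10 ler01 (le_trans ler01 K21) K21; rewrite powR1.
have powX (y : R) : (`|y| `^ (q - 1)) ^+ 2 = `|y| `^ (2 * q - 2).
  by rewrite -powR_mulrn ?powR_ge0// -powRrM; congr (_ `^ _); lra.
exists (2 * (2 * K) `^ (q - 1)); first lra.
move=> N x D Q N0 D0 Q0 p.
have n0 : 0 < N%:R :> R by rewrite ltr0n.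
set n := Num.sqrt (N%:R : R).
have n1 : 1 <= n by exact: sqrt_ge1.
have n2 : n ^+ 2 = N%:R by rewrite sqr_sqrtr// ltW.
have [q2|q2] := leP q 2.
  have -> : p = 2 by apply/max_idPl; lra.
  have -> : Num.min 1 (q / 2) = q / 2 by apply/min_idPr; lra.
  rewrite powR12_sqrt ?(ltW n0)// -/n => H.
  set y := K * (D * n + Q) in H.
  have y0 : 0 < y by rewrite mulr_gt0 ?addr_gt0 ?mulr_gt0//; lra.
  have H2 : \sum_(i < N) x i ^+ 2 <= y ^+ 2.
    rewrite -(powR_mulrn 2 (ltW y0)); apply: le_trans H; apply: ler_sum => i _.
    by rewrite (powR_mulrn 2)// real_normK ?num_real.
  pose c := (y / n) ^+ 2; have c0 : 0 < c by rewrite exprn_gt0// divr_gt0//; lra.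
  apply: (@le_trans _ _ (2 * N%:R * c `^ (q - 1))).
    apply: (@le_trans _ _ (\sum_(i < N) (c `^ (q - 1) * (1 + x i ^+ 2 / c)))).
      apply: ler_sum => i _.
      have -> : (`|x i| `^ (q - 1)) ^+ 2 = c `^ (q - 1) * (x i ^+ 2 / c) `^ (q - 1).
        rewrite -powRM ?(ltW c0) ?divr_ge0 ?sqr_ge0 ?(ltW c0)//.
        rewrite [c * _]mulrC divfK ?gt_eqF// -(real_normK (num_real (x i))).
        by rewrite powR_sqrC.
      rewrite ler_pM2l ?powR_gt0//; apply: powR_le1D; last by apply/andP; split; lra.
      by rewrite divr_ge0 ?sqr_ge0// ltW.
    rewrite -mulr_sumr big_split/= sumr_const card_ord -mulr_suml.
    have : \sum_(i < N) x i ^+ 2 / c <= N%:R.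
      rewrite -mulr_suml ler_pdivrMr//; apply: (le_trans H2).
      rewrite -n2 /c expr_div_n mulrC divfK// expf_neq0// gt_eqF//; lra.
    rewrite -mulr_suml => h.
    have := ler_wpM2l (powR_ge0 c (q - 1)) h; rewrite -mulr_natl mulr1; lra.
  have yn : (y / n) `^ (q - 1) <= (2 * K) `^ (q - 1) *
      (D `^ (q - 1) + Q `^ (q - 1) / n `^ (q - 1)).
    have -> : y / n = K * (D + Q / n).
      by rewrite /y; field; rewrite gt_eqF//; lra.
    have Qn : 0 <= Q / n by rewrite divr_ge0 ?(ltW Q0)//; lra.
    rewrite powRM ?addr_ge0 ?(ltW D0)//; last lra.
    rewrite (@powRM _ 2) ?mulrA//; last lra.
    rewrite (mulrC (2 `^ _)) -mulrA ler_wpM2l ?powR_ge0//.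
    apply: (le_trans (powRD_le q10 (ltW D0) Qn)).
    rewrite ler_wpM2l ?powR_ge0// lerD2l powRM ?invr_ge0 ?(ltW Q0)//; last lra.
    by rewrite powRV//; lra.
  have nE : N%:R `^ (1 - q / 2) = n / n `^ (q - 1).
    rewrite -n2 -powR_mulrn; last lra.
    rewrite -powRrM -{2}[n]powRr1; last lra.
    rewrite -powRN -powRD; last by apply/implyP => _; rewrite gt_eqF//; lra.
    congr (_ `^ _); lra.
  rewrite nE.
  have -> : 2 * N%:R * c `^ (q - 1) = 2 * (n * (y / n) `^ (q - 1)) ^+ 2.
    have yn0 : 0 <= y / n by rewrite divr_ge0 ?(ltW y0)//; lra.
    by rewrite /c [in RHS]exprMn n2 powR_sqrC ?mulrA.
  set z := (y / n) `^ (q - 1) in yn *.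
  have z0 : 0 <= z by exact: powR_ge0.
  have -> : 2 * (2 * K) `^ (q - 1) * (n * D `^ (q - 1) + n / n `^ (q - 1) * Q `^ (q - 1)) =
     2 * (n * ((2 * K) `^ (q - 1) * (D `^ (q - 1) + Q `^ (q - 1) / n `^ (q - 1)))).
    by ring.
  set z' := _ * (D `^ _ + _) in yn *.
  have nz : n * z <= n * z' by rewrite ler_wpM2l//; lra.
  have nz0 : 0 <= n * z by rewrite mulr_ge0//; lra.
  nra.
have -> : p = 2 * q - 2 by apply/max_idPr; lra.
have -> : Num.min 1 (q / 2) = 1 by apply/min_idPl; lra.
rewrite subrr powRr0 mul1r => H.
under eq_bigr do rewrite powX.
apply: (le_trans H).
have y0 : 0 <= K * (D * N%:R `^ (2 * q - 2)^-1 + Q).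
  by rewrite mulr_ge0 ?addr_ge0 ?mulr_ge0 ?powR_ge0 ?(ltW D0) ?(ltW Q0)//; lra.
rewrite -(ger0_norm y0) -powX (ger0_norm y0).
rewrite ler_pXn2r ?nnegrE ?powR_ge0//; last first.
  by rewrite !(mulr_ge0, addr_ge0) ?powR_ge0 ?sqrtr_ge0.
have DN0 : 0 <= D * N%:R `^ (2 * q - 2)^-1 by rewrite mulr_ge0 ?powR_ge0 ?(ltW D0).
rewrite powRM ?addr_ge0 ?(ltW Q0)//; last lra.
apply: (@le_trans _ _ (K `^ (q - 1) * (2 `^ (q - 1) *
   ((D * N%:R `^ (2 * q - 2)^-1) `^ (q - 1) + Q `^ (q - 1))))).
  by rewrite ler_wpM2l ?powR_ge0// powRD_le// ltW.
rewrite mulrA [K `^ _ * _]mulrC -powRM//; last lra.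
rewrite (@powRM _ D) ?powR_ge0 ?(ltW D0)// -powRrM.
rewrite (_ : (2 * q - 2)^-1 * (q - 1) = 2^-1); last first.
  by field; rewrite gt_eqF//; lra.
rewrite powR12_sqrt ?(ltW n0)// -/n [D `^ _ * n]mulrC.
rewrite ler_wpM2r ?ler_peMl ?powR_ge0//; last lra.
by rewrite addr_ge0 ?powR_ge0// mulr_ge0 ?powR_ge0//; lra.
Qed.

End deterministic_bounds.

(** * Uniform bounds over finite classes *)

Section finite_classes.
Context {R : realType} (C1 : R).
Hypothesis hC1 : 1 < C1.

Section setting.
Context {dT : measure_display} {T : measurableType dT} (mu : probability T R).
Context (F : set (T -> R)) (d : (T -> R) -> (T -> R) -> R) (D Gamma : R)
  (A_ : nat -> set (T -> R)).
Hypothesis st : chaining_setting C1 mu F d D Gamma A_.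

Lemma setting_subgaussian0 f delta : F f -> 0 < delta -> d f (fun=> 0) <= delta ->
  subgaussian_tail C1 mu f delta.
Proof.
move=> Ff delta0 df.
have := setting_subgaussian st Ff (setting_zero st) delta0 df.
by rewrite (_ : (fun x => f x - 0) = f)//; apply/funext => x; rewrite subr0.
Qed.

Lemma setting_subgaussianD f : F f -> subgaussian_tail C1 mu f D.
Proof.
move=> Ff; apply: setting_subgaussian0 => //; first exact: (setting_D st).
exact: (setting_diam st Ff (setting_zero st)).
Qed.

Lemma setting_chaining (dW : measure_display) (W : measurableType dW)
    (P : probability W R) (H : set (T -> R)) (J n0 : nat) (u : R)
    (L : R -> R -> (T -> R) -> (T -> R) -> W -> Prop) :
  H `<=` F -> (H #<= `I_J)%card -> 1 <= u -> u <= 2 ^+ n0 ->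
  (forall t delta a b, 2 ^+ n0 <= t -> F a -> F b -> 0 < delta -> d a b <= delta ->
    exists bad : set W, [/\ measurable bad, (P bad <= (3 * expR (- (6 * t)))%:E)%E &
      forall w, ~ bad w -> L t delta a b w]) ->
  exists (H' : set (T -> R)) (bad : set W), [/\ finite_set H', H' `<=` F,
    measurable bad, (P bad <= (expR (- u) / 2)%:E)%E &
    forall w f, ~ bad w -> H f ->
    exists M (s : nat -> T -> R) (delta : nat -> R), [/\ s 0%N = fun=> 0, s M = f,
      (forall k, (k <= M)%N -> H' (s k)),
      (forall k, (k < M)%N -> 0 < delta k /\
        L (2 ^+ (n0 + k)) (delta k) (s k.+1) (s k) w) &
      \sum_(0 <= k < M) level (n0 + k) * delta k <= level n0 * D + 11 * Gamma]].
Proof.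
move=> HF cH u1 un HL; case: st => mF F0 sg ge0 rf sy tr di D0 G0 sA cA smA.
exact: (generic_chaining G0 ge0 sA smA cA rf sy tr di F0 HF cH u1 un HL).
Qed.

End setting.

Lemma level_le_sqrt n (x : R) : 0 <= x -> 2 ^+ n <= 2 * x -> level n <= 2 * Num.sqrt x.
Proof.
move=> x0 nx; rewrite -(@ler_pXn2r _ 2) ?nnegrE ?mulr_ge0 ?sqrtr_ge0 ?(ltW (level_gt0 _))//.
by rewrite level_sqr exprMn sqr_sqrtr//; apply: (le_trans nx); lra.
Qed.

(** The chain starts at the level n0 with 2^n0 of the order of N^(2/p) or u, whichever is
    larger: before it, a link would cost N^(1/p) and not 2^(n/2). *)
Lemma uniform_power_sum (p : R) : 2 <= p -> exists2 K : R, 1 <= K &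
  forall (dT : measure_display) (T : measurableType dT) (mu : probability T R)
    (dW : measure_display) (W : measurableType dW) (P : probability W R)
    (N : nat) (X_ : 'I_N -> {RV P >-> T}), (0 < N)%N -> iid_sample mu X_ ->
  forall F d D Gamma A_, chaining_setting C1 mu F d D Gamma A_ ->
  forall (H : set (T -> R)) (u : R), H `<=` F -> finite_set H -> 1 <= u ->
  exists bad : set W, [/\ measurable bad, (P bad <= (expR (- u) / 2)%:E)%E &
    forall w f, ~ bad w -> H f -> \sum_(i < N) `|f (X_ i w)| `^ p <=
      (K * (D * N%:R `^ p^-1 + (D * Num.sqrt u + Gamma))) `^ p].
Proof.
move=> p2; have [K0 K01 HK] := power_sum_tail hC1 p2.
exists (11 * K0); first lra.
move=> dT T mu dW W P N X_ N0 iid F d D Gamma A_ st H u HF [J /card_eqP fH] u1.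
have cH : (H #<= `I_J)%card by move: fH => [f]; apply/card_leP; squash f.
have D0 := setting_D st; have G0 := setting_Gamma st.
(* The first level has to dominate both N^(2/p) and u. *)
pose x := Num.max (N%:R `^ (2 / p)) u : R.
have x1 : 1 <= x by rewrite le_max u1 orbT.
have [n0 /andP[xn nx]] := pow2_between x1.
have un : u <= 2 ^+ n0 by apply: le_trans xn; rewrite le_max lexx orbT.
have Nn : N%:R `^ (2 / p) <= 2 ^+ n0 by apply: le_trans xn; rewrite le_max lexx.
have p0 : 0 < p by lra.
pose L t delta (a b : T -> R) w := \sum_(i < N) `|a (X_ i w) - b (X_ i w)| `^ p
  <= (K0 * (delta * Num.sqrt t)) `^ p.
have [t delta a b tn Fa Fb delta0 dab|H' [bad [_ _ mbad Pbad Hbad]]] :=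
    @setting_chaining _ _ _ _ _ _ _ _ st _ W P H J n0 u L HF cH u1 un.
  have mab : measurable_fun setT (fun y => a y - b y).
    by apply: measurable_funB; exact: (setting_meas st).
  apply: (HK _ _ mu _ _ P N X_ N0 iid (fun y => a y - b y)) => //.
  - by apply: lt_le_trans tn; rewrite exprn_gt0.
  - have -> : N%:R = (N%:R `^ (2 / p)) `^ (p / 2) :> R.
      have e1 : 2 / p * (p / 2) = 1 by field; rewrite gt_eqF.
      by rewrite -powRrM e1 powRr1// ler0n.
    rewrite ge0_ler_powR ?nnegrE ?powR_ge0 ?(le_trans _ tn) ?exprn_ge0//; lra.
  - exact: (setting_subgaussian st).
exists bad; split => // w f /Hbad{}Hbad /Hbad[M [s [delta [s0 sM _ Hs sumle]]]].
have h := @sum_powR_chain R N M p K0 (fun k i => s k (X_ i w))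
  (fun k => level (n0 + k) * delta k).
rewrite -sM; apply: le_trans (h _ _ _ _ _) _.
- lra.
- lra.
- by move=> k /Hs[k0 _]; rewrite mulr_gt0 ?level_gt0.
- by move=> i; rewrite s0.
- by move=> k /Hs[_]; rewrite /L (mulrC (delta k)).
have sum0 : 0 <= \sum_(0 <= k < M) level (n0 + k) * delta k.
  rewrite big_nat_cond; apply: sumr_ge0 => k; rewrite andbT => /andP[_ /Hs[k0 _]].
  by rewrite mulr_ge0 ?(ltW (level_gt0 _)) ?ltW.
have Np0 : 0 <= N%:R `^ p^-1 :> R by exact: powR_ge0.
have su0 : 0 <= Num.sqrt u by exact: sqrtr_ge0.
have lx : level n0 <= 2 * (N%:R `^ p^-1 + Num.sqrt u).
  apply: (le_trans (level_le_sqrt _ nx)); first lra.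
  rewrite ler_pM2l// /x; case: (leP (N%:R `^ (2 / p)) u) => _; first by rewrite lerDr.
  rewrite -powR12_sqrt ?powR_ge0// -powRrM (_ : 2 / p * 2^-1 = p^-1) ?lerDl//.
  by field; rewrite gt_eqF.
rewrite ge0_ler_powR ?nnegrE//; [lra|by rewrite mulr_ge0//; lra| |].
  by rewrite mulr_ge0 ?addr_ge0 ?mulr_ge0//; lra.
rewrite (mulrC 11) -mulrA ler_pM2l; last lra.
apply: (le_trans sumle).
have := ler_wpM2r (ltW D0) lx.
have := mulr_ge0 (ltW D0) Np0; have := mulr_ge0 (ltW D0) su0; lra.
Qed.

(** The l_p bound is applied to the points of all chains, and not to H alone, because the
    estimate of a link involves the (q-1)-st powers of both its ends. *)
Lemma finite_class_bound (q : R) : 1 <= q -> exists2 K : R, 1 <= K &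
  forall (dT : measure_display) (T : measurableType dT) (mu : probability T R)
    (dW : measure_display) (W : measurableType dW) (P : probability W R)
    (N : nat) (X_ : 'I_N -> {RV P >-> T}), (0 < N)%N -> iid_sample mu X_ ->
  forall F d D Gamma A_, chaining_setting C1 mu F d D Gamma A_ ->
  forall (H : set (T -> R)) (u : R), H `<=` F -> finite_set H -> 1 <= u ->
  exists bad : set W, [/\ measurable bad, (P bad <= (expR (- u))%:E)%E &
    forall w f, ~ bad w -> H f ->
      let Q := D * Num.sqrt u + Gamma in
      `|\sum_(i < N) `|f (X_ i w)| `^ q - N%:R * \int[mu]_x (`|f x| `^ q)| <=
      K * (Q * (Num.sqrt N%:R * D `^ (q - 1) +
                N%:R `^ (1 - Num.min 1 (q / 2)) * Q `^ (q - 1)))].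
Proof.
move=> q1; have [K1 K11 HK1] := power_increment_tail hC1 q1.
pose p := Num.max 2 (2 * q - 2).
have p2 : 2 <= p by rewrite le_max lexx.
have [K2 K21 HK2] := uniform_power_sum p2.
have [C C_1 HC] := sum_sqr_powR_le q1 K21.
exists (22 * (K1 * C)).
  have : 1 <= K1 * C by rewrite -[leLHS]mulr1 ler_pM.
  lra.
move=> dT T mu dW W P N X_ N0 iid F d D Gamma A_ st H u HF [J /card_eqP fH] u1.
have cH : (H #<= `I_J)%card by move: fH => [f]; apply/card_leP; squash f.
have D0 := setting_D st; have G0 := setting_Gamma st.
have su0 : 0 <= Num.sqrt u by exact: sqrtr_ge0.
pose Q := D * Num.sqrt u + Gamma.
have Q0 : 0 < Q by rewrite /Q ltr_wpDl// mulr_ge0// ltW.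
pose A : R := Num.sqrt N%:R * D `^ (q - 1).
pose B := N%:R `^ (1 - Num.min 1 (q / 2)) * Q `^ (q - 1).
have A0 : 0 < A by rewrite mulr_gt0 ?powR_gt0// sqrtr_gt0 ltr0n.
have B0 : 0 <= B by rewrite mulr_ge0 ?powR_ge0.
pose S := C * (A + B).
have S0 : 0 < S by rewrite mulr_gt0//; lra.
have [n0 /andP[un nu]] := pow2_between u1.
have DS f : F f -> subgaussian_tail C1 mu f D by exact: (setting_subgaussianD st).
pose V (f : T -> R) w := \sum_(i < N) (`|f (X_ i w)| `^ (q - 1)) ^+ 2 <= S ^+ 2.
pose y (f : T -> R) w := \sum_(i < N) `|f (X_ i w)| `^ q - N%:R * \int[mu]_x (`|f x| `^ q).
pose L t delta (a b : T -> R) w := V a w -> V b w ->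
  `|y a w - y b w| <= K1 * (delta * Num.sqrt t * (A + S)).
have [t delta a b tn Fa Fb delta0 dab|H' [bad1 [finH' H'F mbad1 Pbad1 Hbad1]]] :=
    @setting_chaining _ _ _ _ _ _ _ _ st _ W P H J n0 u L HF cH u1 un.
  have t0 : 0 < t by apply: lt_le_trans tn; rewrite exprn_gt0.
  have [B' [mB PB HB]] := HK1 _ _ mu _ _ P N X_ N0 iid a b delta D t
    (setting_meas st Fa) (setting_meas st Fb) delta0 D0 t0
    (setting_subgaussian st Fa Fb delta0 dab) (DS _ Fa) (DS _ Fb).
  exists B'; split => // w /HB{}HB Va Vb; apply: le_trans (HB S S0 Va Vb).
  rewrite /y sumrB mulrBr le_eqVlt; apply/orP; left; apply/eqP; congr `|_|.
  by rewrite !opprD !opprK addrACA.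
have [bad2 [mbad2 Pbad2 Hbad2]] :=
  HK2 _ _ mu _ _ P N X_ N0 iid F d D Gamma A_ st H' u H'F finH' u1.
exists (bad1 `|` bad2); split; first exact: measurableU.
  rewrite (_ : (expR (- u))%:E = ((expR (- u) / 2)%:E + (expR (- u) / 2)%:E)%E).
    by apply: le_trans (measureU2 _ mbad1 mbad2) _; rewrite leeD.
  by rewrite -EFinD -splitr.
move=> w f /not_orP[b1 b2] Hf /=; rewrite -/Q -/A -/B.
have VH' g : H' g -> V g w.
  by move=> H'g; apply: (HC N (fun i => g (X_ i w)) D Q N0 D0 Q0); exact: Hbad2.
have [M [s [delta [s0 sM sH' Hs sumle]]]] := Hbad1 w f b1 Hf.
have h := @sum_abs_chain R M (fun k => y (s k) w)
  (fun k => level (n0 + k) * delta k) (K1 * (A + S)).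
have {}h : `|y (s M) w| <= K1 * (A + S) * \sum_(0 <= k < M) level (n0 + k) * delta k.
  apply: h => [|k kM].
    have q0 : q != 0 by rewrite gt_eqF//; lra.
    rewrite /y s0 big1; last by move=> i _; rewrite normr0 powR0.
    rewrite (_ : (fun x : T => `|0| `^ q) = cst 0); last first.
      by apply/funext => x; rewrite normr0 powR0.
    by rewrite Rintegral_cst// mul0r mulr0 subr0.
  have [_ Hk] := Hs k kM.
  apply: le_trans (Hk (VH' _ (sH' _ kM)) (VH' _ (sH' _ (ltnW kM)))) _.
  by rewrite -/(level (n0 + k)) -(mulrA K1) [in leRHS](mulrC (A + S)) (mulrC (delta k)).
rewrite sM in h; apply: (le_trans h).
have lu : level n0 <= 2 * Num.sqrt u by apply: level_le_sqrt => //; lra.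
have sQ : \sum_(0 <= k < M) level (n0 + k) * delta k <= 11 * Q.
  apply: (le_trans sumle); have := ler_wpM2r (ltW D0) lu.
  by have := mulr_ge0 (ltW D0) su0; rewrite /Q; lra.
have KA0 : 0 <= K1 * (A + S) by rewrite mulr_ge0//; lra.
apply: (le_trans (ler_wpM2l KA0 sQ)).
have AS : A + S <= 2 * (C * (A + B)).
  have : A <= C * (A + B).
    apply: (@le_trans _ _ (A + B)); first by rewrite lerDl.
    by rewrite ler_peMl//; lra.
  by rewrite /S; lra.
have KQ : 0 <= 11 * K1 * Q by rewrite !mulr_ge0 ?(ltW Q0)//; lra.
have -> : K1 * (A + S) * (11 * Q) = 11 * K1 * Q * (A + S) by ring.
apply: (le_trans (ler_wpM2l KQ AS)).
by rewrite le_eqVlt; apply/orP; left; apply/eqP; ring.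
Qed.

End finite_classes.

(** * From finite to separable classes *)

Section limiting_arguments.
Context {R : realType}.

(** The exceptional sets of an increasing sequence of finite subclasses increase, and so
    their union has probability at most the common bound. *)
Lemma countable_sup_tail {dW : measure_display} {W : measurableType dW}
    (P : probability W R) (U : Type) (G0 : set U) (Z : U -> W -> R) (c e : R) :
  countable G0 -> (forall f, G0 f -> measurable_fun setT (Z f)) ->
  (forall H, H `<=` G0 -> finite_set H -> exists bad : set W,
    [/\ measurable bad, (P bad <= e%:E)%E &
        forall w f, ~ bad w -> H f -> Z f w <= c]) ->
  exists bad : set W, [/\ measurable bad, (P bad <= e%:E)%E &
    forall w f, ~ bad w -> G0 f -> Z f w <= c].
Proof.
move=> /pcard_leP[idx] mZ HB.
pose H m := [set f | G0 f /\ (idx f < m)%N].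
have HG m : H m `<=` G0 by move=> f [].
have cH m : (H m #<= `I_m)%card.
  apply/pcard_leP/injfunPex; exists idx; first by move=> f [].
  by move=> f g /set_mem[Gf _] /set_mem[Gg _]; apply: (@inj _ _ _ idx); exact: mem_set.
pose B f := [set w | (c < Z f w)%R].
have mB f : G0 f -> measurable (B f).
  move=> /mZ mf; rewrite /B -[X in measurable X]setTI.
  exact: measurable_fun_ltr.
pose BB m := \bigcup_(f in H m) B f.
have mBB m : measurable (BB m).
  have [|mm _] := @probability_bigcup_le R _ _ P _ (H m) m B 1 (cH m) ler01.
    move=> f Hf; have mBf := mB f (HG _ _ Hf); split => //.
    exact: probability_le1.
  exact: mm.
have PBB m : (P (BB m) <= e%:E)%E.
  have [bad [mbad Pbad Hbad]] := HB _ (HG m) (card_le_finite (cH m) (finite_II _)).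
  apply: le_trans Pbad; apply: le_measure; rewrite ?inE//.
  move=> w [f Hf Bf]; apply: contrapT => nb.
  by have := Hbad w f nb Hf; rewrite leNgt Bf.
have mBBT : measurable (\bigcup_m BB m) by exact: bigcupT_measurable.
exists (\bigcup_m BB m); split => //.
  have ndBB : nondecreasing_seq BB.
    move=> m n mn; apply/subsetPset => w [f [Gf fm] Bf]; exists f => //.
    by split => //; exact: leq_trans mn.
  have cv := nondecreasing_cvg_mu (mu := P) mBB mBBT ndBB.
  rewrite -(cvg_lim _ cv)//; apply: lime_le; last exact: nearW.
  by apply/cvg_ex; eexists; exact: cv.
move=> w f nb Gf; rewrite leNgt; apply/negP => Bf; apply: nb.
by exists (idx f).+1 => //; exists f => //; split.
Qed.

Definition power_deviation {dW dT : measure_display} {W : measurableType dW}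
    {T : measurableType dT} {P : probability W R} (mu : probability T R) (q : R)
    (N : nat) (X_ : 'I_N -> {RV P >-> T}) (f : T -> R) (w : W) : R :=
  `|N%:R^-1 * \sum_(i < N) `|f (X_ i w)| `^ q - \int[mu]_x (`|f x| `^ q)|.

Lemma measurable_power_deviation {dW dT : measure_display} {W : measurableType dW}
    {T : measurableType dT} {P : probability W R} (mu : probability T R) (q : R)
    (N : nat) (X_ : 'I_N -> {RV P >-> T}) (f : T -> R) :
  measurable_fun setT f -> measurable_fun setT (power_deviation mu q X_ f).
Proof.
move=> mf; apply: measurableT_comp => //; apply: measurable_funB => //.
apply: measurable_funM => //.
by apply: measurable_iid_sum (measurable_abs_powR q mf).
Qed.

(** Outside a null set each f in G is approximated, simultaneously at all sample points
    and in d, by elements of the countable subclass; the empirical mean is controlled by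
    the pointwise convergence and the expectation by [mean_increment]. *)
Lemma separable_sup_tail (C1 q : R) (dW dT : measure_display)
    (W : measurableType dW) (T : measurableType dT) (P : probability W R)
    (mu : probability T R) (N : nat) (X_ : 'I_N -> {RV P >-> T})
    (F G : set (T -> R)) (d : (T -> R) -> (T -> R) -> R) (D c e : R) :
  1 < C1 -> 1 <= q -> (0 < N)%N -> iid_sample mu X_ ->
  (forall f, F f -> measurable_fun setT f) ->
  (forall f g delta, F f -> F g -> 0 < delta -> d f g <= delta ->
    subgaussian_tail C1 mu (fun x => f x - g x) delta) ->
  0 < D -> (forall f, F f -> subgaussian_tail C1 mu f D) ->
  G `<=` F -> separable_class mu d G ->
  (forall H, H `<=` G -> finite_set H -> exists bad : set W,
    [/\ measurable bad, (P bad <= e%:E)%E &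
        forall w f, ~ bad w -> H f -> power_deviation mu q X_ f w <= c]) ->
  exists bad : set W, [/\ measurable bad, (P bad <= e%:E)%E &
    forall w f, ~ bad w -> G f -> power_deviation mu q X_ f w <= c].
Proof.
move=> hC1 q1 N0 [lawX _] mF sg D0 sD GF [G0 [cG0 G0G] [M [M' [mM' muM' MM']] sep]] HH.
have [bad [mbad Pbad Hbad]] : exists bad : set W,
    [/\ measurable bad, (P bad <= e%:E)%E &
    forall w f, ~ bad w -> G0 f -> power_deviation mu q X_ f w <= c].
  apply: countable_sup_tail => //.
    by move=> f /G0G/GF/mF; exact: measurable_power_deviation.
  by move=> H HG0; apply: HH; exact: subset_trans G0G.
(* The sample points that fall in the null set where the approximation fails. *)
pose Bi (i : nat) := if insub i is Some j then X_ j @^-1` M' else set0.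
have [|mU PU] := @probability_bigsetU_le R _ _ P Bi (fun=> 0) N.
  move=> i iN; rewrite /Bi insubT; split.
    by rewrite -[X in measurable X]setTI; exact: measurable_funPT.
  by have := lawX (Ordinal iN) _ mM'; rewrite muM' /distribution/= /pushforward => ->.
exists (bad `|` \big[setU/set0]_(i < N) Bi i); split.
- exact: measurableU.
- apply: le_trans (measureU2 _ mbad mU) _.
  rewrite -[leRHS]adde0 leeD//; apply: (le_trans PU).
  by rewrite lee_fin big1.
move=> w f /not_orP[nb nU] Gf.
have [f_ [f_G0 df pf]] := sep f Gf.
have nM i : ~ M (X_ i w).
  move=> /MM' M'w; apply: nU; rewrite -bigcup_mkord; exists (i : nat) => //=.
  by rewrite /Bi valK.
have [K K1 HK] := mean_increment hC1 q1.
have q10 : 0 <= q - 1 by lra.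
apply/ler_addgt0Pr => eps eps0.
pose c1 i := q * (2 * (`|f (X_ i w)| + 1) `^ (q - 1)).
have c10 i : 0 <= c1 i by rewrite mulr_ge0 ?mulr_ge0 ?powR_ge0//; lra.
pose cc := N%:R^-1 * \sum_(i < N) c1 i + K * D `^ (q - 1).
have cc1 : 0 < cc.
  rewrite ltr_wpDl ?mulr_gt0 ?powR_gt0//; last lra.
  by rewrite mulr_ge0 ?sumr_ge0// invr_ge0.
pose eta := Num.min 1 (eps / cc).
have eta0 : 0 < eta by rewrite lt_min ltr01 divr_gt0.
have eta1 : eta <= 1 by rewrite ge_min lexx.
have etac : eta * cc <= eps by rewrite -ler_pdivlMr// ge_min lexx orbT.
have [n [dn fn]] : exists n, d (f_ n) f <= eta /\
    forall i, `|f_ n (X_ i w) - f (X_ i w)| <= eta.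
  have h1 : \forall n \near \oo, d (f_ n) f <= eta.
    have /cvgrPdist_le /(_ _ eta0) := df; apply: filterS => n.
    by rewrite sub0r normrN; apply: le_trans; exact: ler_norm.
  have h2 : \forall n \near \oo, forall i : 'I_N, `|f_ n (X_ i w) - f (X_ i w)| <= eta.
    apply: filter_forall => i.
    have /cvgrPdist_le /(_ _ eta0) := pf _ (nM i); apply: filterS => n.
    by rewrite distrC.
  by have [n [a b]] := filter_ex (filterI h1 h2); exists n.
have Ff := GF _ Gf; have Ffn := GF _ (G0G _ (f_G0 n)).
have Zn := Hbad w (f_ n) nb (f_G0 n).
have mean := HK _ _ mu (f_ n) f eta D (mF _ Ffn) (mF _ Ff) eta0 D0
  (sg _ _ _ Ffn Ff eta0 dn) (sD _ Ffn) (sD _ Ff).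
have samp : `|N%:R^-1 * \sum_(i < N) `|f_ n (X_ i w)| `^ q -
     N%:R^-1 * \sum_(i < N) `|f (X_ i w)| `^ q| <= eta * (N%:R^-1 * \sum_(i < N) c1 i).
  rewrite -mulrBr -sumrB normrM ger0_norm ?invr_ge0// mulrCA ler_wpM2l ?invr_ge0//.
  apply: le_trans (ler_norm_sum _ _ _) _; rewrite mulr_sumr; apply: ler_sum => i _.
  apply: (le_trans (powR_diff q1 (normr_ge0 _) (normr_ge0 _))).
  rewrite /c1 [leRHS]mulrCA ler_wpM2l//; first lra.
  have hi : `| `|f_ n (X_ i w)| - `|f (X_ i w)| | <= eta.
    by apply: le_trans (fn i); exact: ler_dist_dist.
  rewrite ler_pM ?addr_ge0 ?powR_ge0//.
  have mono (v : R) : 0 <= v -> v <= `|f (X_ i w)| + 1 ->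
      v `^ (q - 1) <= (`|f (X_ i w)| + 1) `^ (q - 1).
    by move=> v0 vle; apply: ge0_ler_powR => //; rewrite nnegrE//; exact: le_trans vle.
  have h1 : `|f (X_ i w)| `^ (q - 1) <= (`|f (X_ i w)| + 1) `^ (q - 1).
    by apply: mono => //; rewrite lerDl.
  have h2 : `|f_ n (X_ i w)| `^ (q - 1) <= (`|f (X_ i w)| + 1) `^ (q - 1).
    by apply: mono => //; have := le_trans (ler_norm _) hi; lra.
  lra.
rewrite /power_deviation in Zn *.
set a := N%:R^-1 * \sum_(i < N) `|f_ n (X_ i w)| `^ q in Zn samp.
set b := N%:R^-1 * \sum_(i < N) `|f (X_ i w)| `^ q in samp *.
set ma := Rintegral _ _ _ in Zn mean; set mb := Rintegral _ _ _ in mean *.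
have -> : b - mb = (a - ma) - (a - b) + (ma - mb) by ring.
apply: (le_trans (ler_normD _ _)).
apply: (@le_trans _ _ (c + eta * cc)); last by rewrite lerD2l.
rewrite /cc mulrDr addrA; apply: lerD; last by rewrite mulrCA.
by apply: (le_trans (ler_normB _ _)); exact: lerD.
Qed.

End limiting_arguments.

(** * The rate of the deviation inequality *)

Section rate.
Context {R : realType}.

Definition rate (q : R) (N : nat) (D Gamma u : R) : R :=
  Gamma `^ q * (N%:R `^ Num.min 1 (q / 2))^-1
  + D `^ (q - 1) * Gamma * (Num.sqrt N%:R)^-1
  + D `^ q * (Num.sqrt (u / N%:R) + u `^ (q / 2) / N%:R `^ Num.min 1 (q / 2)).

(** Q^q is split by convexity, up to a factor 2^q, into the powers of D sqrt u and of
    Gamma. *)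
Lemma deviation_le_rate (q : R) N (D Gamma u Q : R) : 1 <= q -> (0 < N)%N -> 0 < D ->
  0 < Gamma -> 1 <= u -> Q = D * Num.sqrt u + Gamma ->
  N%:R^-1 * (Q * (Num.sqrt N%:R * D `^ (q - 1) +
                N%:R `^ (1 - Num.min 1 (q / 2)) * Q `^ (q - 1))) <=
  2 `^ q * rate q N D Gamma u.
Proof.
move=> q1 N0 D0 G0 u1 QD.
have q0 : 0 < q by lra.
have n0 : 0 < N%:R :> R by rewrite ltr0n.
have u0 : 0 <= u by lra.
have su0 : 0 <= Num.sqrt u by exact: sqrtr_ge0.
have Q0 : 0 < Q by rewrite QD ltr_wpDl// mulr_ge0// ltW.
set m := Num.min 1 (q / 2).
set n := Num.sqrt (N%:R : R).
have sn0 : 0 < n by rewrite sqrtr_gt0.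
have n2 : N%:R = n * n :> R by rewrite -expr2 sqr_sqrtr// ltW.
have m0 : 0 < N%:R `^ m by rewrite powR_gt0.
have NE : N%:R `^ (1 - m) = N%:R / N%:R `^ m.
  by rewrite powRB ?powRr1 ?(ltW n0)//; apply/implyP => _; rewrite gt_eqF.
have QE : Q * Q `^ (q - 1) = Q `^ q by rewrite mulr_powRB1// ltW.
have DE : D * D `^ (q - 1) = D `^ q by rewrite mulr_powRB1// ltW.
have Qle : Q `^ q <= 2 `^ q * (D `^ q * u `^ (q / 2) + Gamma `^ q).
  have Ds0 : 0 <= D * Num.sqrt u by rewrite mulr_ge0// ltW.
  rewrite QD; apply: (le_trans (powRD_le (ltW q0) Ds0 (ltW G0))).
  rewrite ler_wpM2l ?powR_ge0// lerD2r powRM ?(ltW D0)//.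
  by rewrite -powR12_sqrt// -powRrM (mulrC 2^-1).
have c1 : 1 <= 2 `^ q :> R.
  by apply: le_trans (le1r_powR _ q1); lra.
have sq : Num.sqrt (u / N%:R) = Num.sqrt u / n.
  by rewrite sqrtrM// sqrtrV// ltW.
have -> : N%:R^-1 * (Q * (n * D `^ (q - 1) + N%:R `^ (1 - m) * Q `^ (q - 1))) =
    (D `^ q * (Num.sqrt u / n) + D `^ (q - 1) * Gamma * n^-1) + Q `^ q / N%:R `^ m.
  rewrite NE -QE -DE n2 QD; field.
  by rewrite !gt_eqF// -n2.
have h1 : Q `^ q / N%:R `^ m <=
    2 `^ q * (D `^ q * (u `^ (q / 2) / N%:R `^ m) + Gamma `^ q * (N%:R `^ m)^-1).
  rewrite ler_pdivrMr//; apply: (le_trans Qle).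
  rewrite -mulrA ler_wpM2l ?powR_ge0// mulrDl.
  by rewrite -!mulrA !mulVf ?gt_eqF// !mulr1.
have h2 : D `^ q * (Num.sqrt u / n) + D `^ (q - 1) * Gamma * n^-1 <=
    2 `^ q * (D `^ q * (Num.sqrt u / n) + D `^ (q - 1) * Gamma * n^-1).
  rewrite ler_peMl// addr_ge0// ?mulr_ge0 ?powR_ge0 ?invr_ge0 ?(ltW G0) ?(ltW sn0)//.
apply: (le_trans (lerD h2 h1)).
rewrite -mulrDr ler_wpM2l ?powR_ge0// /rate -/m -/n sq.
by rewrite le_eqVlt; apply/orP; left; apply/eqP; ring.
Qed.

Lemma finite_deviation (C1 q : R) : 1 < C1 -> 1 <= q -> exists2 K : R, 0 < K &
  forall (dT : measure_display) (T : measurableType dT) (mu : probability T R)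
    (dW : measure_display) (W : measurableType dW) (P : probability W R)
    (N : nat) (X_ : 'I_N -> {RV P >-> T}), (0 < N)%N -> iid_sample mu X_ ->
  forall F d D Gamma A_, chaining_setting C1 mu F d D Gamma A_ ->
  forall (H : set (T -> R)) (u : R), H `<=` F -> finite_set H -> 1 <= u ->
  exists bad : set W, [/\ measurable bad, (P bad <= (expR (- u))%:E)%E &
    forall w f, ~ bad w -> H f ->
      power_deviation mu q X_ f w <= K * rate q N D Gamma u].
Proof.
move=> hC1 q1; have [K K1 HK] := finite_class_bound hC1 q1.
exists (K * 2 `^ q); first by rewrite mulr_gt0 ?powR_gt0//; lra.
move=> dT T mu dW W P N X_ N0 iid F d D Gamma A_ st H u HF fH u1.
have [bad [mbad Pbad Hbad]] := HK _ _ mu _ _ P N X_ N0 iid _ _ _ _ _ st H u HF fH u1.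
exists bad; split => // w f nb Hf.
have n0 : 0 < N%:R :> R by rewrite ltr0n.
have hR := deviation_le_rate q1 N0 (setting_D st) (setting_Gamma st) u1 erefl.
have hB := Hbad w f nb Hf.
have iN0 : 0 <= N%:R^-1 :> R by rewrite invr_ge0 ltW.
rewrite /power_deviation.
set s := \sum_(i < N) _ in hB *; set m := Rintegral _ _ _ in hB *.
have -> : N%:R^-1 * s - m = N%:R^-1 * (s - N%:R * m).
  by rewrite mulrBr mulrA mulVf ?mul1r// gt_eqF.
rewrite normrM (ger0_norm iN0).
apply: (le_trans (ler_wpM2l iN0 hB)).
by rewrite mulrCA -mulrA ler_wpM2l//; lra.
Qed.

End rate.

(** * Transfer to the sample space and the functional gamma2 *)

Section transfer.
Context {R : realType} {dT : measure_display} {T : measurableType dT}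
  (mu : probability T R).
Context {dW : measure_display} {W : measurableType dW} (P : probability W R)
  (X : {RV P >-> T}).
Hypothesis lawX : forall B, measurable B -> distribution P X B = mu B.
Context (C1 : R) (F : set (T -> R)) (d : (T -> R) -> (T -> R) -> R).
Hypothesis mF : forall f, F f -> measurable_fun setT f.
Hypothesis distd : is_distance mu d F.

Lemma ae_eq_measure0 (f g : T -> R) : measurable_fun setT f ->
  measurable_fun setT g -> {ae mu, forall x, f x = g x} ->
  measurable [set x | f x != g x] /\ mu [set x | f x != g x] = 0%E.
Proof.
move=> mf mg fg.
have mN : measurable [set x | f x != g x].
  rewrite [X in measurable X](_ : _ = setT `&` (fun x => f x - g x) @^-1` (~` [set 0])).
    by apply: measurable_funB => //; exact: measurableC.
  rewrite setTI; apply/seteqP; split => x /=.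
    by move=> /eqP h /eqP; rewrite subr_eq0 => /eqP.
  by move=> h; apply/eqP => fgx; apply: h; rewrite fgx subrr.
split => //; apply/negligibleP => //.
by apply: negligibleS fg => x /= /eqP.
Qed.

(** When d f g = 0 the tail bound comes from f = g almost everywhere, and not from the
    sub-Gaussian hypothesis, whose right-hand side is then C1. *)
Lemma subgaussian_law : 1 < C1 -> subgaussian_increments C1 P X d F ->
  forall f g delta, F f -> F g -> 0 < delta -> d f g <= delta ->
  subgaussian_tail C1 mu (fun x => f x - g x) delta.
Proof.
move=> hC1 sg f g delta Ff Fg delta0 dfg u u0.
have [d0 _ dae _ _] := distd.
have mfg : measurable_fun setT (fun x => f x - g x).
  by apply: measurable_funB; exact: mF.
have mA : measurable [set x | u <= `|f x - g x|].
  rewrite -[X in measurable X]setTI; apply: measurable_fun_ler => //.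
  exact: measurableT_comp.
have [dz|dn] := eqVneq (d f g) 0.
  have [mN muN] := ae_eq_measure0 (mF Ff) (mF Fg) (dae _ _ Ff Fg dz).
  apply: (@le_trans _ _ (mu [set x | f x != g x])).
    apply: le_measure; rewrite ?inE// => x /=; apply: contraTneq => ->.
    by rewrite subrr normr0 -ltNge.
  by rewrite muN lee_fin mulr_ge0 ?expR_ge0//; lra.
have dpos : 0 < d f g by rewrite lt_neqAle eq_sym dn d0.
rewrite -lawX//; apply: le_trans (sg f g Ff Fg u u0) _.
rewrite lee_fin ler_pM2l; last lra.
rewrite ler_expR lerN2 ler_pM2l ?exprn_gt0// lef_pV2 ?posrE ?exprn_gt0//.
by rewrite ler_pXn2r ?nnegrE// ltW.
Qed.

Lemma empirical_deviationE (q : R) (N : nat) (X_ : 'I_N -> {RV P >-> T})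
    (f : T -> R) (w : W) :
  measurable_fun setT f -> mu.-integrable setT (EFin \o (fun x => `|f x| `^ q)) ->
  empirical_deviation P q X (fun i => X_ i : W -> T) f w =
  (power_deviation mu q X_ f w)%:E.
Proof.
move=> mf intf; rewrite /empirical_deviation /power_deviation expectation.unlock.
have mfq := measurable_abs_powR q mf.
have -> : (\int[P]_w' (`|f (X w')| `^ q)%:E = (\int[mu]_x (`|f x| `^ q))%R%:E)%E.
  have := @ge0_integral_distribution _ _ W T R P X (fun x => (`|f x| `^ q)%:E).
  move=> <-; last 2 first.
  - exact/measurable_EFinP.
  - by move=> x; rewrite lee_fin powR_ge0.
  rewrite (@eq_measure_integral _ _ _ _ mu) => [|A mA _]; last exact: lawX.
  by rewrite /Rintegral fineK//; exact: (integrable_fin_num _ intf).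
by rewrite -EFinB.
Qed.

(** The case of diameter 0, where a chaining with positive D is not available. *)
Lemma power_deviation_ae0 (q : R) (N : nat) (X_ : 'I_N -> {RV P >-> T})
    (H : set (T -> R)) : 0 < q -> iid_sample mu X_ -> H `<=` F -> F (fun=> 0) ->
  finite_set H -> (forall f, H f -> d f (fun=> 0) = 0) ->
  exists bad : set W, [/\ measurable bad, (P bad <= 0)%E &
    forall w f, ~ bad w -> H f -> power_deviation mu q X_ f w = 0].
Proof.
move=> q0 [lawX_ _] HF F0 [J /card_eqP fH] dH0.
have cH : (H #<= `I_J)%card by move: fH => [h]; apply/card_leP; squash h.
have [_ _ dae _ _] := distd.
have fN f : H f -> measurable [set x | f x != 0] /\ mu [set x | f x != 0] = 0%E.
  move=> Hf; have mf := mF (HF _ Hf).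
  apply: (@ae_eq_measure0 f (fun=> 0) mf (measurable_cst _)).
  exact: dae (HF _ Hf) F0 (dH0 _ Hf).
pose B (f : T -> R) (i : nat) :=
  if insub i is Some j then X_ j @^-1` [set x | f x != 0] else set0.
pose BB f := \big[setU/set0]_(i < N) B f i.
have HBB f : H f -> measurable (BB f) /\ (P (BB f) <= 0%:E)%E.
  move=> Hf; have [mN muN] := fN f Hf.
  have [|mU PU] := @probability_bigsetU_le R _ _ P (B f) (fun=> 0) N.
    move=> i iN; rewrite /B insubT; split.
      by rewrite -[X in measurable X]setTI; exact: measurable_funPT.
    by have := lawX_ (Ordinal iN) _ mN; rewrite muN /distribution/= /pushforward => ->.
  by split => //; apply: (le_trans PU); rewrite lee_fin big1.
have [mB PB] := probability_bigcup_le cH (lexx 0) HBB.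
exists (\bigcup_(f in H) BB f); split => //.
  by rewrite mulr0 in PB.
move=> w f nb Hf; have [mN muN] := fN f Hf.
have f0 i : f (X_ i w) = 0.
  apply/eqP; apply: contrapT => /negP fi; apply: nb; exists f => //.
  by rewrite /BB -bigcup_mkord; exists (i : nat) => //=; rewrite /B valK.
have q00 : q != 0 by rewrite gt_eqF.
rewrite /power_deviation big1; last by move=> i _; rewrite f0 normr0 powR0.
rewrite mulr0 sub0r normrN /Rintegral.
rewrite (ae_eq_integral (cst 0%E))//.
- by rewrite integral0/= normr0.
- exact/measurable_EFinP/measurable_abs_powR/mF/HF.
- exists [set x | f x != 0]; split => // x /= /not_implyP[_]; apply: contra_not_neq.
  by move=> ->; rewrite normr0 powR0.
Qed.

End transfer.

Section gamma_functional.
Context {R : realType} {U : Type} (d : U -> U -> R) (F : set U).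
Hypothesis d_ge0 : forall f g, F f -> F g -> 0 <= d f g.

Lemma gamma2_ge0 f0 : F f0 -> (0 <= gamma2 d F)%E.
Proof.
move=> F0; apply: le_ereal_inf_tmp => _ [A_ [AF _ _ _ _] <-].
apply: le_ereal_sup_tmp; eexists; first by exists f0.
apply: nneseries_ge0 => n _ _; rewrite mule_ge0 ?lee_fin ?powR_ge0//.
by apply: le_ereal_inf_tmp => _ [g Ag <-]; rewrite lee_fin d_ge0//; exact: AF Ag.
Qed.

Lemma gamma2_lt_admissible (Gamma : R) : (gamma2 d F < Gamma%:E)%E ->
  exists A_ : nat -> set U, [/\ forall n, A_ n `<=` F, (A_ 0%N #= `I_1)%card,
    forall n, (A_ n #<= `I_(2 ^ (2 ^ n))%N)%card & forall f, F f ->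
      (\sum_(0 <= n <oo) ((2 `^ (n%:R / 2))%:E * dist_set d f (A_ n)) <= Gamma%:E)%E].
Proof.
move=> /ereal_inf_lt[_ [A_ [AF A0 cA _ _] <-] /ltW supG]; exists A_; split => // f Ff.
by apply: le_trans supG; apply: ereal_sup_ubound; exists f.
Qed.

(** A_0 is a single point, and every f is within Gamma of it, up to the error allowed in
    [approximating_points]. *)
Lemma diameter_le_gamma2 (Gamma : R) : 0 < Gamma ->
  (forall f g, F f -> F g -> d f g = d g f) ->
  (forall f g h, F f -> F g -> F h -> d f h <= d f g + d g h) ->
  (gamma2 d F < Gamma%:E)%E -> (diameter d F <= (6 * Gamma)%:E)%E.
Proof.
move=> G0 dsym dtri /gamma2_lt_admissible[A_ [AF A0 cA sA]].
have [proj [r Hr]] := approximating_points G0 d_ge0 AF sA.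
apply: ge_ereal_sup => _ [f Ff [g Fg <-]]; rewrite lee_fin.
have near h : F h -> A_ 0%N (proj 0%N h) /\ d h (proj 0%N h) <= 3 * Gamma.
  move=> Fh; have [/(_ 0%N)[Ah hr r0] /(_ 1%N)] := Hr h Fh.
  rewrite big_nat1 /level expr0 sqrtr1 mul1r => h3; split => //.
  exact: le_trans hr h3.
have [Af hf] := near f Ff; have [Ag hg] := near g Fg.
have e : proj 0%N f = proj 0%N g.
  have /pcard_leP[i] : (A_ 0%N #<= `I_1)%card by rewrite (card_le_eql A0) card_lexx.
  apply: (@inj _ _ _ i); rewrite ?inE//.
  have := funS (s := i) _ Af; have := funS (s := i) _ Ag; rewrite /= !ltnS !leqn0.
  by move=> /eqP -> /eqP ->.
have Fp := AF _ _ Af.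
apply: (le_trans (dtri f (proj 0%N f) g Ff Fp Fg)).
rewrite (dsym _ _ Fp Fg); rewrite -e in hg; lra.
Qed.

End gamma_functional.

(* The supremum is over an arbitrary separable subclass G of F: G = F whenever F
   is separable (e.g. countable), and any countable G otherwise.  Over a
   nonseparable F the pointwise supremum depends on the versions of the f in F
   and the bound fails (singleton indicators under Lebesgue measure, with an
   arbitrarily small distance). *)
Theorem theorem1 (R : realType) (C1 : R) (hC1 : 1 < C1) (q : R) (hq : 1 <= q) :
  exists C : R, 0 < C /\
  forall (dT : measure_display) (Omega : measurableType dT)
    (mu : probability Omega R)
    (F : set (Omega -> R)) (d : (Omega -> R) -> (Omega -> R) -> R)
    (dW : measure_display) (W : measurableType dW) (P : probability W R)
    (X : {RV P >-> Omega}) (N : nat) (X_ : 'I_N -> {RV P >-> Omega}),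
  (forall B, measurable B -> distribution P X B = mu B) ->
  (forall f, F f -> f \in Lfun mu q%:E) ->
  F (fun=> 0) ->
  is_distance mu d F ->
  subgaussian_increments C1 P X d F ->
  (0 < N)%N ->
  (forall i B, measurable B -> distribution P (X_ i) B = mu B) ->
  independent_RVs P (fun i => X_ i : W -> Omega) ->
  forall G : set (Omega -> R), G `<=` F -> separable_class mu d G ->
  forall u : R, 1 <= u ->
  exists E : set W,
    [/\ measurable E,
        ((1 - expR (- u))%:E <= P E)%E &
        forall w, E w ->
        (ereal_sup [set empirical_deviation P q X (fun i => X_ i : W -> Omega) f w
                   | f in G]
         <= C%:E *
            (poweR (gamma2 d F) q * (N%:R `^ Num.min 1 (q / 2))^-1%:E
             + poweR (diameter d F) (q - 1) * gamma2 d F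
               * (Num.sqrt N%:R)^-1%:E
             + poweR (diameter d F) q
               * (Num.sqrt (u / N%:R)
                  + u `^ (q / 2) / N%:R `^ Num.min 1 (q / 2))%:E))%E].
Proof.
have [K K0 HK] := finite_deviation hC1 hq.
have q0 : 0 < q by lra.
have two2 : 2 <= 2 `^ q by apply: le1r_powR => //; lra.
exists (K * 2 `^ q); split; first by rewrite mulr_gt0 ?powR_gt0.
move=> dT Omega mu F d dW W P X N X_ lawX FLq F0 distd sg N0 lawX_ indX G GF sepG u u1.
have iid : iid_sample mu X_ by [].
have [d_ge0 d_refl _ d_sym d_tri] := distd.
have mF f : F f -> measurable_fun setT f.
  by move=> /FLq Lf; have := set_mem (sub_Lfun_mfun Lf).
have sgmu := subgaussian_law lawX mF distd hC1 sg.
have sgD D : 0 < D -> (forall f g, F f -> F g -> d f g <= D) ->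
    forall f, F f -> subgaussian_tail C1 mu f D.
  move=> D0 dD f Ff; have := sgmu f (fun=> 0) D Ff F0 D0 (dD _ _ Ff F0).
  by rewrite (_ : (fun x => f x - 0) = f)//; apply/funext => x; rewrite subr0.
have g_ge0 : (0 <= gamma2 d F)%E by exact: gamma2_ge0 F0.
have diam_ub f g : F f -> F g -> ((d f g)%:E <= diameter d F)%E.
  by move=> Ff Fg; apply: ereal_sup_ubound; exists f => //; exists g.
have diam_ge0 : (0 <= diameter d F)%E.
  by have := diam_ub _ _ F0 F0; rewrite d_refl.
have m0 : 0 < N%:R `^ Num.min 1 (q / 2) :> R by apply: powR_gt0; rewrite ltr0n.
(* An infinite functional makes the right-hand side infinite. *)
have [goo|gfin] := eqVneq (gamma2 d F) +oo%E.
  exists setT; split => //.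
    by rewrite probability_setT lee_fin gerBl expR_ge0.
  move=> w _; rewrite [leRHS](_ : _ = +oo%E) ?leey// goo poweRyr ?gt_eqF//.
  rewrite gt0_mulye ?lte_fin ?invr_gt0// addye; last first.
    rewrite gt_eqF// (lt_le_trans ltNy0)// mule_ge0 ?lee_fin ?invr_ge0 ?sqrtr_ge0//.
    by rewrite mule_ge0 ?poweR_ge0.
  rewrite addye; last first.
    rewrite gt_eqF// (lt_le_trans ltNy0)// mule_ge0 ?poweR_ge0//.
    by rewrite lee_fin addr_ge0 ?sqrtr_ge0// divr_ge0 ?powR_ge0.
  by rewrite gt0_muley// lte_fin mulr_gt0 ?powR_gt0.
have gE : gamma2 d F = (fine (gamma2 d F))%:E.
  by rewrite fineK// ge0_fin_numE// ltey.
pose g := fine (gamma2 d F); rewrite -/g in gE.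
have g0 : 0 <= g by rewrite fine_ge0.
have diam_le Gm : g < Gm -> (diameter d F <= (6 * Gm)%:E)%E.
  move=> gGm; apply: diameter_le_gamma2 => //; first exact: le_lt_trans gGm.
  by rewrite gE lte_fin.
have DE : diameter d F = (fine (diameter d F))%:E.
  rewrite fineK// ge0_fin_numE//; apply: le_lt_trans (diam_le (g + 1) _) (ltry _).
  by rewrite ltrDl.
pose D := fine (diameter d F); rewrite -/D in DE.
have D_ge0 : 0 <= D by rewrite fine_ge0.
have D_ub f h : F f -> F h -> d f h <= D.
  by move=> Ff Fh; rewrite -lee_fin -DE diam_ub.
(* In particular the functional is positive as soon as the diameter is. *)
have D6g : D <= 6 * g.
  apply/ler_addgt0Pr => e e0; rewrite -lee_fin -DE.
  have -> : 6 * g + e = 6 * (g + e / 6) by lra.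
  by apply: diam_le; rewrite ltrDl divr_gt0.
have D10 : 0 < D + 1 by lra.
have D1_ub f h : F f -> F h -> d f h <= D + 1.
  by move=> Ff Fh; apply: le_trans (D_ub _ _ Ff Fh) _; rewrite lerDl.
have rate0 : 0 <= rate q N D g u.
  rewrite /rate !addr_ge0// ?mulr_ge0 ?powR_ge0 ?invr_ge0 ?sqrtr_ge0 ?(ltW m0)//.
  by rewrite addr_ge0 ?sqrtr_ge0// divr_ge0 ?powR_ge0.
have [bad [mbad Pbad Hbad]] : exists bad : set W,
    [/\ measurable bad, (P bad <= (expR (- u))%:E)%E &
     forall w f, ~ bad w -> G f ->
       power_deviation mu q X_ f w <= K * 2 `^ q * rate q N D g u].
  apply: (@separable_sup_tail _ C1 q _ _ _ _ P mu N X_ F G d (D + 1)) => //.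
    exact: sgD.
  move=> H HG fH; have HF : H `<=` F by exact: subset_trans GF.
  have [D0|Dneg] := ltP 0 D; last first.
    have [|bad [mbad Pbad Hbad]] := power_deviation_ae0 mF distd q0 iid HF F0 fH.
      move=> f /HF Ff; apply/eqP; rewrite eq_le d_ge0// andbT.
      exact: le_trans (D_ub _ _ Ff F0) Dneg.
    exists bad; split => //; first by apply: (le_trans Pbad); rewrite lee_fin expR_ge0.
    by move=> w f nb Hf; rewrite Hbad// !mulr_ge0 ?powR_ge0 ?(ltW K0).
  have gpos : 0 < g by lra.
  have [A_ [subA _ cardA sumA]] : exists A_ : nat -> set (Omega -> R),
      [/\ forall n, A_ n `<=` F, (A_ 0%N #= `I_1)%card,
       forall n, (A_ n #<= `I_(2 ^ (2 ^ n))%N)%card & forall f, F f ->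
       (\sum_(0 <= n <oo) ((2 `^ (n%:R / 2))%:E * dist_set d f (A_ n)) <=
          (2 * g)%:E)%E].
    by apply: gamma2_lt_admissible; rewrite gE lte_fin; lra.
  (* Twice the functional leaves room for a near-optimal admissible sequence. *)
  have st : chaining_setting C1 mu F d D (2 * g) A_.
    by split => //; rewrite mulr_gt0.
  have [bad [mbad Pbad Hbad]] := HK _ _ mu _ _ P N X_ N0 iid _ _ _ _ _ st H u HF fH u1.
  exists bad; split => // w f nb Hf; apply: le_trans (Hbad w f nb Hf) _.
  rewrite -mulrA ler_pM2l// /rate powRM// !mulrDr; apply: lerD; first apply: lerD.
  - by rewrite mulrA.
  - rewrite !mulrA ler_wpM2r ?invr_ge0 ?sqrtr_ge0// ler_wpM2r// mulrC.
    by rewrite ler_wpM2r ?powR_ge0.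
  - rewrite -!mulrDr ler_peMl//; last lra.
    by rewrite mulr_ge0 ?powR_ge0// addr_ge0 ?sqrtr_ge0// divr_ge0 ?powR_ge0.
exists (~` bad); split; first exact: measurableC.
  by rewrite probability_setC// EFinB leeB.
move=> w nb; apply: ge_ereal_sup => _ [f Gf <-]; have Ff := GF _ Gf.
rewrite (@empirical_deviationE _ _ _ mu)//; last first.
- exact: (integrable_powR hC1 hq (mF _ Ff) D10 (sgD _ D10 D1_ub _ Ff)).
- exact: mF.
rewrite gE DE !poweR_EFin -!EFinM lee_fin.
exact: Hbad.
Qed.
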